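(* Fix an integer $p\ge2$. There is a constant $C_p>0$, depending only on $p$, such that the following holds. Let $N\ge1$ be an integer, $L_p>0$, $D>0$, $n\ge 2N+1$ an integer, and fix a starting point $z_0\in\mathbb{R}^n$. For every deterministic $p$th-order method initialized at $z_0$, there exists a $\mathcal{C}^{p-1}$ monotone operator $F:\mathbb{R}^n\to\mathbb{R}^n$ with $p$th-order Lipschitz constant at most $L_p$ and a unique zero $z^*$ satisfying $\|z_0-z^*\|=D$, for which the output $z_N$ after $N$ oracle queries satisfies $$\mathrm{res}^{\mathrm{tan}}(z_N)=\|F(z_N)\|\ge C_p\,\frac{L_pD^p}{(N+1)^{(3p-1)/2}}.$$
   Context: Norms are Euclidean. ''$p$th-order Lipschitz constant at most $L_p$'' means $\|D^{p-1}F(z)-D^{p-1}F(z')\|_{\mathrm{op}}\le L_p\|z-z'\|$ for all $z,z'$, with $\|\cdot\|_{\mathrm{op}}$ the induced multilinear operator norm. Monotone means $\langle F(z)-F(z'),z-z'\rangle\ge0$ for all $z,z'$. A deterministic $p$th-order method initialized at $z_0$ chooses, for each $t\ge1$, its $t$th point $z_t$ as an arbitrary deterministic function of $z_0$ and the previous oracle outputs $\{D^jF(z_s):0\le j\le p-1,\ 0\le s<t\}$, where $D^0F=F$. Thus the output $z_N$ is a deterministic function of $z_0$ and the oracle outputs at $z_0,\dots,z_{N-1}$ (which are $N$ oracle queries). For the inclusion $0\in F(z)+H(z)$, the tangent residual is $\mathrm{res}^{\mathrm{tan}}(z)=\inf_{v\in H(z)}\|F(z)+v\|$; here $H\equiv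 0$, so it equals $\|F(z)\|$. *)

(* Defs.v *)
From HB Require Import structures.
From mathcomp Require Import all_boot all_order all_algebra.
From mathcomp Require Import all_classical all_reals all_analysis.

Set Implicit Arguments.
Unset Strict Implicit.
Unset Printing Implicit Defensive.

Import Order.TTheory GRing.Theory Num.Theory.
Import numFieldNormedType.Exports.
Local Open Scope classical_set_scope.
Local Open Scope ring_scope.

(* The library norm on 'rV[R]_n is the max norm.  It is only used through the
   topology and the Frechet differential 'd, which do not depend on the choice
   of a norm; all quantitative statements use the Euclidean norm enorm. *)
Definition dotp (R : realType) (n : nat) (u v : 'rV[R]_n) : R :=
  \sum_(i < n) u ord0 i * v ord0 i.

Definition enorm (R : realType) (n : nat) (u : 'rV[R]_n) : R :=
  Num.sqrt (dotp u u).

Definition monotone_op (R : realType) (n : nat) (F : 'rV[R]_n -> 'rV[R]_n) :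
  Prop := forall z z', 0 <= dotp (F z - F z') (z - z').

(* Dseq F [:: h_1; ...; h_j] z is D^j F(z)[h_1, ..., h_j]: since evaluation of
   a multilinear map at fixed arguments is linear,
     D^(j+1) F(z)[h, h_1, ..., h_j]
       = D (y |-> D^j F(y)[h_1, ..., h_j])(z)[h]. *)
Fixpoint Dseq (R : realType) (n : nat) (F : 'rV[R]_n -> 'rV[R]_n)
    (hs : seq 'rV[R]_n) : 'rV[R]_n -> 'rV[R]_n :=
  if hs is h :: hs' then fun z => 'd (Dseq F hs') z h else F.

Definition Dn (R : realType) (n : nat) (F : 'rV[R]_n -> 'rV[R]_n) (j : nat)
  (z : 'rV[R]_n) : j.-tuple 'rV[R]_n -> 'rV[R]_n := fun hs => Dseq F hs z.

(* In finite dimension, z |-> D^j F(z) is differentiable (resp. continuous) as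
   a map into j-linear maps iff all its evaluations at fixed vectors are. *)
Definition is_Ck (R : realType) (n k : nat) (F : 'rV[R]_n -> 'rV[R]_n) : Prop :=
  (forall (j : nat) (hs : j.-tuple 'rV[R]_n), (j < k)%N ->
     forall z, differentiable (fun y => Dn F y hs) z) /\
  (forall (j : nat) (hs : j.-tuple 'rV[R]_n), (j <= k)%N ->
     continuous (fun y => Dn F y hs)).

(* Extended-real valued, so that an unbounded T gets norm +oo. *)
Definition opnorm (R : realType) (n j : nat)
    (T : j.-tuple 'rV[R]_n -> 'rV[R]_n) : \bar R :=
  ereal_sup [set (enorm (T hs))%:E |
              hs in [set hs | forall i : 'I_j, enorm (tnth hs i) <= 1]].

Definition lipschitz_order (R : realType) (n p : nat) (L : R)
    (F : 'rV[R]_n -> 'rV[R]_n) : Prop :=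
  forall z z' : 'rV[R]_n,
    (opnorm (fun hs => Dn F (j := p.-1) z hs - Dn F (j := p.-1) z' hs)%R
       <= (L * enorm (z - z'))%:E)%E.

Definition oracle_output (R : realType) (n p : nat) : Type :=
  forall j : 'I_p, j.-tuple 'rV[R]_n -> 'rV[R]_n.

Definition oracle (R : realType) (n p : nat) (F : 'rV[R]_n -> 'rV[R]_n)
  (z : 'rV[R]_n) : oracle_output R n p := fun j => Dn F (j := j) z.

(* A method maps z_0 and the outputs at z_0, ..., z_(t-1), in this order, to
   z_t; the length of the sequence determines t.  The value of a method on the
   empty sequence is never used. *)
Definition method (R : realType) (n p : nat) : Type :=
  'rV[R]_n -> seq (oracle_output R n p) -> 'rV[R]_n.

Definition next_point (R : realType) (n p : nat) (A : method R n p)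
    (z0 : 'rV[R]_n) (outs : seq (oracle_output R n p)) : 'rV[R]_n :=
  if outs is [::] then z0 else A z0 outs.

Fixpoint outputs (R : realType) (n p : nat) (A : method R n p)
    (z0 : 'rV[R]_n) (F : 'rV[R]_n -> 'rV[R]_n) (t : nat) :
    seq (oracle_output R n p) :=
  if t is s.+1 then
    let outs := outputs A z0 F s in
    rcons outs (@oracle R n p F (next_point A z0 outs))
  else [::].

Definition iterate (R : realType) (n p : nat) (A : method R n p)
    (z0 : 'rV[R]_n) (F : 'rV[R]_n -> 'rV[R]_n) (t : nat) : 'rV[R]_n :=
  next_point A z0 (outputs A z0 F t).

Definition res_tan (R : realType) (n : nat) (F : 'rV[R]_n -> 'rV[R]_n)
    (H : 'rV[R]_n -> set 'rV[R]_n) (z : 'rV[R]_n) : \bar R :=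
  ereal_inf [set (enorm (F z + v))%:E | v in H z].

(* Main.v *)
(* The hard operator is a chain on N+1 hidden orthonormal directions with
   coordinates w_0, ..., w_N of z - z0.  Neighbouring coordinates are coupled by a
   skew flow g(w_{i+1}) e_i - g(w_i) e_{i+1}, where g is a spline that vanishes
   on the negative axis and has slope 1 from T = p-1 on.  Its Jacobian is
   skew except where the two slopes g' differ; the defect there is compensated by
   a bounded friction on each coordinate and by convex ridges that vanish on a
   cone around w_i = w_{i+1}.
   A bounded friction only makes the coordinates of the zero decrease by O(1)
   from node to node, so they are all of order N, the flow through the chain is
   of order N, and |z*| is of order N^{3/2}.  Adding mu (z - z0) with mu of order
   1/N makes the zero unique, and does not affect D^{p-1}F(z) - D^{p-1}F(z')
   because p >= 2.  If w_N(z) = 0, strong monotonicity between z and z* gives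
   |F(z)| |z - z*| >= mu |z - z*|^2 + c N^2, hence |F(z)| >= c' N^{1/2}, and
   rescaling yields the exponent 3p/2 - 1/2.  Since g is flat at 0, a query at a
   point with w_i = 0 for all i >= t reveals at most e_0, ..., e_t, so that
   e_{t+1} may be chosen orthogonal to the next query point. *)
Require Import Defs.
From HB Require Import structures.
From mathcomp Require Import all_boot all_order all_algebra.
From mathcomp Require Import all_classical all_reals all_analysis.
From mathcomp Require Import ring lra zify.

Set Implicit Arguments.
Unset Strict Implicit.
Unset Printing Implicit Defensive.

Import Order.TTheory GRing.Theory Num.Theory.
Import numFieldNormedType.Exports.
Local Open Scope classical_set_scope.
Local Open Scope ring_scope.

(** * A differentiability criterion *)

(** A quadratic remainder bound treats the kink of [max(s, 0)] at 0 on the same footing as every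
    other point. *)
Lemma is_derive_quadratic_error (R : realType) (f : R -> R) (t l C : R) :
  (forall s, `|f s - f t - l * (s - t)| <= C * (s - t) ^+ 2) ->
  is_derive t 1 f l.
Proof.
move=> H.
have C0 : 0 <= C.
  have := le_trans (normr_ge0 _) (H (t + 1)).
  by have -> : t + 1 - t = 1 :> R by [ring]; rewrite expr1n mulr1.
have cv : (fun h : R => h^-1 *: ((f \o shift t) (h *: 1) - f t)) @ 0^' --> l.
  apply/cvgrPdist_le => /= e e0; near=> h.
  have h0 : h != 0 by near: h; exact: nbhs_dnbhs_neq.
  rewrite /shift /= scaler1.
  have := H (h + t); rewrite addrK => Hh.
  rewrite distrC -(ler_pM2l (_ : 0 < `|h|)) ?normr_gt0// -normrM.
  have -> : h * (h^-1 *: (f (h + t) - f t) - l) = f (h + t) - f t - l * h.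
    by rewrite /GRing.scale /= mulrBr mulrA divff// mul1r (mulrC h l).
  apply: (le_trans Hh); rewrite -real_normK ?num_real// expr2 mulrCA.
  rewrite ler_wpM2l//.
  (* Dividing by [C + 1] rather than [C] covers the case [C = 0]. *)
  have hlt : `|h| < e / (C + 1).
    near: h; apply: dnbhs0_lt; first by rewrite divr_gt0// ltr_wpDl.
  apply: (@le_trans _ _ (C * (e / (C + 1)))); first by rewrite ler_wpM2l// ltW.
  rewrite mulrCA ger_pMr// ler_pdivrMr ?ltr_wpDl// mul1r lerDl//.
constructor; first by apply/cvg_ex; exists l.
exact/cvg_lim.
Unshelve. all: by end_near. Qed.

(** * Splines *)

Definition tpow (R : realType) (q : nat) (t : R) : R :=
  Num.max t 0 ^+ q / q`!%:R.

Lemma tpow1 (R : realType) (t : R) : tpow 1 t = Num.max t 0.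
Proof. by rewrite /tpow expr1 divr1. Qed.

Definition bdiff (R : realType) (f : R -> R) (t : R) : R := f t - f (t - 1).

(* [spl m q] is the [m]-th backward difference of [t_+^q / q!]; [spl m m] is a
   smooth step from 0 to 1, a convolution of [m] unit boxes integrated once. *)
Definition spl (R : realType) (m q : nat) : R -> R := iter m (@bdiff R) (tpow q).

(** The square of the positive part has remainder at most [(s - t) ^+ 2] around every [t]. Higher
    powers follow by the product rule, since [s * max(s, 0) ^ q.+2 = max(s, 0) ^ q.+3]. *)
Lemma is_derive_max0X (R : realType) (q : nat) (t : R) :
  is_derive t 1 (fun s : R => Num.max s 0 ^+ q.+2)
    (q.+2%:R * Num.max t 0 ^+ q.+1).
Proof.
elim: q => [|q IH].
  apply: (@is_derive_quadratic_error _ _ _ _ 1) => s; rewrite mul1r expr1 ler_norml.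
  rewrite /Num.max; case: (ltP s 0) => ?; case: (ltP t 0) => ?; apply/andP; split;
    have := sqr_ge0 (s - t); have := sqr_ge0 s; have := sqr_ge0 t; rewrite !expr2; nra.
have -> : (fun s : R => Num.max s 0 ^+ q.+3) = id * (fun s : R => Num.max s 0 ^+ q.+2).
  apply/funext => s /=; rewrite /GRing.mul /= exprS /Num.max; case: ltP => //.
  by rewrite exprS !mul0r mulr0.
apply: is_derive_eq.
rewrite /GRing.scale /= mulr1.
have tM : t * Num.max t 0 = Num.max t 0 * Num.max t 0.
  by rewrite /Num.max; case: ltP => //; rewrite !mulr0.
have -> : t * (q.+2%:R * Num.max t 0 ^+ q.+1) = q.+2%:R * (t * Num.max t 0) * Num.max t 0 ^+ q.
  by rewrite exprS; ring.
by rewrite tM -[q.+3%:R]natr1 !exprS; ring.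
Qed.

Lemma is_derive_tpow (R : realType) (q : nat) (t : R) :
  is_derive t 1 (@tpow R q.+2) (tpow q.+1 t).
Proof.
have -> : @tpow R q.+2 = (q.+2`!%:R)^-1 *: (fun s : R => Num.max s 0 ^+ q.+2).
  by apply/funext => s; rewrite /tpow mulrC.
have D := is_derive_max0X q t.
apply: is_derive_eq.
rewrite /tpow /GRing.scale /= [in LHS]factS natrM.
have f0 : q.+1`!%:R != 0 :> R by rewrite pnatr_eq0 -lt0n fact_gt0.
have q0 : q.+2%:R != 0 :> R by rewrite pnatr_eq0.
set M := Num.max t 0 ^+ q.+1.
move: (q.+1`!%:R : R) (q.+2%:R : R) f0 q0 M => a b a0 b0 M.
by field; rewrite a0 b0.
Qed.

Lemma splS (R : realType) (m q : nat) (t : R) :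
  spl m.+1 q t = spl m q t - spl m q (t - 1).
Proof. by []. Qed.

Lemma spl_le0 (R : realType) (m q : nat) (t : R) :
  (0 < q)%N -> t <= 0 -> spl m q t = 0.
Proof.
move=> q0; elim: m t => [|m IH] t t0.
  by rewrite /spl /= /tpow max_r// expr0n gtn_eqF// mul0r.
by rewrite splS !IH ?subr0//; lra.
Qed.

Lemma is_derive_spl (R : realType) (m q : nat) (t : R) :
  is_derive t 1 (@spl R m q.+2) (spl m q.+1 t).
Proof.
elim: m t => [|m IH] t; first exact: is_derive_tpow.
have D1 := IH t; have D2 := IH (t - 1).
have D3 : is_derive t 1 (fun s => spl m q.+2 (s - 1)) (spl m q.+1 (t - 1)).
  have D4 := is_derive_shift t 1 (-1 : R).
  have := @is_derive1_comp R (spl m q.+2) (shift (-1)) t _ _ D2 D4.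
  by rewrite mulr1.
have -> : @spl R m.+1 q.+2 = spl m q.+2 - (fun s => spl m q.+2 (s - 1)) by [].
exact: is_deriveB.
Qed.

(** Each backward difference at most doubles the Lipschitz constant, which is 1 for the positive
    part. *)
Lemma spl1_lipschitz (R : realType) (m : nat) (t s : R) :
  `|spl m 1 t - spl m 1 s| <= 2 ^+ m * `|t - s|.
Proof.
elim: m t s => [|m IH] t s.
  rewrite /spl /= !tpow1 expr0 mul1r.
  have := ler_norm (t - s); have := ler_norm (s - t); rewrite (distrC s t).
  rewrite ler_norml /Num.max.
  by case: (ltP t 0) => ?; case: (ltP s 0) => ? ? ?; apply/andP; split; lra.
rewrite !splS.
have -> : forall a b c d : R, a - b - (c - d) = (a - c) - (b - d) by move=> *; ring.
apply: (le_trans (ler_normB _ _)); rewrite exprS mulrAC mulr_natl mulr2n mulrDl.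
have := IH (t - 1) (s - 1).
have -> : t - 1 - (s - 1) = t - s by ring.
have := IH t s; rewrite mulr2n ; lra.
Qed.

Lemma MVT_all (R : realType) (f df : R -> R) (a b : R) : a <= b ->
  (forall x : R, is_derive x 1 f (df x)) ->
  exists2 c, c \in `[a, b] & f b - f a = df c * (b - a).
Proof.
move=> ab H; apply: MVT_segment => //.
apply: continuous_subspaceT => x.
apply: differentiable_continuous; apply/derivable1_diffP.
exact: (@ex_derive _ _ _ _ _ _ _ (H x)).
Qed.

(** Differencing an antiderivative is averaging: by the mean value theorem [spl m.+2 m.+2 t] is a
    value of [spl m.+1 m.+1] on [[t - 1, t]]. Hence the range persists and saturation is delayed by
    1. The derivative of the new spline is a backward difference of the old one, so monotonicity
    persists too. *)
Lemma splineP (R : realType) (m : nat) :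
  [/\ forall t : R, 0 <= spl m.+1 m.+1 t <= 1,
      forall t : R, m.+1%:R <= t -> spl m.+1 m.+1 t = 1 &
      forall s t : R, s <= t -> spl m.+1 m.+1 s <= spl m.+1 m.+1 t].
Proof.
elim: m => [|m [I1 I2 I3]].
  have E : forall t : R, spl 1 1 t = Num.max t 0 - Num.max (t - 1) 0.
    by move=> t; rewrite splS /spl /= !tpow1.
  split=> [t|t|s t]; rewrite !E /Num.max; do ?[case: ltP => ? //].
  all: try (move=> ?); try (apply/andP; split); try lra.
have M (t : R) : exists2 c, c \in `[t - 1, t] & spl m.+2 m.+2 t = spl m.+1 m.+1 c.
  have tt : t - 1 <= t by lra.
  have [c cI ce] := MVT_all tt (is_derive_spl m.+1 m : forall x, _).
  exists c => //; rewrite splS ce.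
  by rewrite opprB addrC subrK mulr1.
split=> [t|t tm|s t st].
- by have [c _ ->] := M t.
- have [c + ->] := M t; rewrite in_itv /= => /andP[c1 _]; apply: I2.
  by move: tm; rewrite -natr1; lra.
- have [c _ ce] := MVT_all st (is_derive_spl m.+2 m : forall x, _).
  rewrite -subr_ge0 ce; apply: mulr_ge0; last by rewrite subr_ge0.
  by rewrite splS subr_ge0 I3//; lra.
Qed.

(** * Sums of ridge functions and their derivatives *)

Lemma dotp_is_linear (R : realType) (n : nat) (a : 'rV[R]_n) :
  linear_for *%R (dotp a).
Proof.
move=> k u v; rewrite /dotp mulr_sumr -big_split; apply: eq_bigr => i _ /=.
by rewrite !mxE; ring.
Qed.

HB.instance Definition _ (R : realType) (n : nat) (a : 'rV[R]_n) :=
  GRing.isLinear.Build R 'rV[R]_n R *%R (dotp a) (dotp_is_linear a).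

Lemma dotpC (R : realType) (n : nat) (u v : 'rV[R]_n) : dotp u v = dotp v u.
Proof. by apply: eq_bigr => i _; rewrite mulrC. Qed.

Lemma is_diff_dotp (R : realType) (n : nat) (a z : 'rV[R]_n) :
  is_diff z (dotp a) (dotp a).
Proof.
have D x : differentiable (dotp a) x.
  have -> : dotp a = \sum_(i < n) (a ord0 i *: (fun u : 'rV[R]_n => u ord0 i)).
    by apply/funext => u; rewrite fct_sumE.
  apply: differentiable_sum => i; apply: differentiableZ.
  exact: differentiable_coord.
constructor; first exact: D.
rewrite diff_lin // => x; exact: differentiable_continuous.
Qed.

Lemma is_diff_dotpB (R : realType) (n : nat) (a z0 z : 'rV[R]_n) (tau : R) :
  is_diff z (fun y => dotp a (y - z0) - tau) (dotp a).
Proof.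
have D := is_diff_dotp a z.
have -> : (fun y => dotp a (y - z0) - tau) = dotp a - cst (dotp a z0 + tau).
  by apply/funext => y /=; rewrite linearB /= opprD addrA.
by apply: is_diff_eq; rewrite subr0.
Qed.

(** The scalar [s] stands for the product of the pairings produced by earlier differentiations. *)
Lemma is_diff_ridge (R : realType) (n : nat) (g : R -> R) (dg s : R)
    (a z0 v z : 'rV[R]_n) (tau : R) :
  is_derive (dotp a (z - z0) - tau) 1 g dg ->
  is_diff z (fun y => (g (dotp a (y - z0) - tau) * s) *: v)
            (fun h => (dg * (dotp a h * s)) *: v).
Proof.
move=> Dg; have D := is_diff_dotpB a z0 z tau.
have Dg' : is_diff (dotp a (z - z0) - tau) g (fun h => h * dg).
  have der : derivable g (dotp a (z - z0) - tau) 1 by exact: ex_derive.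
  constructor; first exact/derivable1_diffP.
  by rewrite diff1E ?derive1E ?derive_val//; apply/derivable1_diffP.
have D1 := is_diff_comp D Dg'.
have -> : (fun y => (g (dotp a (y - z0) - tau) * s) *: v) =
    ( *:%R^~ (s *: v)) \o (g \o (fun y => dotp a (y - z0) - tau)).
  by apply/funext => y /=; rewrite scalerA.
apply: is_diff_eq.
by apply/funext => h /=; rewrite scalerA; congr (_ *: _); ring.
Qed.

(* The triple [(a, tau, v)] stands for [z |-> g (<a, z - z0> - tau) v]. *)
Definition ridge (R : realType) (n : nat) : Type :=
  ('rV[R]_n * R * 'rV[R]_n)%type.

(* [G j] plays the role of the [j]-th derivative of [G 0]. *)
Definition ridge_sum (R : realType) (n : nat) (G : nat -> R -> R)
    (rs : seq (ridge R n)) (z0 : 'rV[R]_n) (hs : seq 'rV[R]_n)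
    (z : 'rV[R]_n) : 'rV[R]_n :=
  \sum_(m <- rs) (G (size hs) (dotp m.1.1 (z - z0) - m.1.2) *
                  \prod_(h <- hs) dotp m.1.1 h) *: m.2.

Definition affine_part (R : realType) (n : nat) (b : R) (c z0 : 'rV[R]_n)
    (hs : seq 'rV[R]_n) (z : 'rV[R]_n) : 'rV[R]_n :=
  match hs with
  | [::] => c + b *: (z - z0)
  | [:: h] => b *: h
  | _ => 0
  end.

Definition ridge_op (R : realType) (n : nat) (G : nat -> R -> R) (b : R)
    (c : 'rV[R]_n) (rs : seq (ridge R n)) (z0 z : 'rV[R]_n) : 'rV[R]_n :=
  affine_part b c z0 [::] z + ridge_sum G rs z0 [::] z.

Lemma is_diff_ridge_sum (R : realType) (n : nat) (G : nat -> R -> R)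
    (rs : seq (ridge R n)) (z0 z : 'rV[R]_n) (hs : seq 'rV[R]_n) :
  (forall t : R, is_derive t 1 (G (size hs)) (G (size hs).+1 t)) ->
  is_diff z (ridge_sum G rs z0 hs) (fun h => ridge_sum G rs z0 (h :: hs) z).
Proof.
move=> DG; elim: rs => [|m rs IH].
  have -> : ridge_sum G [::] z0 hs = cst 0.
    by apply/funext => y; rewrite /ridge_sum big_nil.
  by apply: is_diff_eq; apply/funext => h; rewrite /ridge_sum big_nil.
have Dm := is_diff_ridge (\prod_(h <- hs) dotp m.1.1 h) m.2
             (DG (dotp m.1.1 (z - z0) - m.1.2)).
have -> : ridge_sum G (m :: rs) z0 hs =
    (fun y => (G (size hs) (dotp m.1.1 (y - z0) - m.1.2) *
               \prod_(h <- hs) dotp m.1.1 h) *: m.2) + ridge_sum G rs z0 hs.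
  by apply/funext => y; rewrite /ridge_sum big_cons.
apply: (is_diff_eq (is_diffD Dm IH)); apply/funext => h.
by rewrite /ridge_sum big_cons /= big_cons.
Qed.

Lemma is_diff_affine_part (R : realType) (n : nat) (b : R)
    (c z0 z : 'rV[R]_n) (hs : seq 'rV[R]_n) :
  is_diff z (affine_part b c z0 hs) (fun h => affine_part b c z0 (h :: hs) z).
Proof.
case: hs => [|h [|h' hs]].
- change (is_diff z (cst c + b *: (id - cst z0)) (fun h => b *: h)).
  have D1 := is_diffB (is_diff_id z) (is_diff_cst z0 z).
  have := is_diffD (is_diff_cst c z) (is_diffZ b D1).
  by rewrite add0r subr0.
- exact: is_diff_cst.
- exact: is_diff_cst.
Qed.

(** Differentiating a ridge along [h] replaces [G j] by [G j.+1] and adds the factor [dotp a h], so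
    iterated differentials stay in one explicit family. *)
Lemma Dseq_ridge_op (R : realType) (n p : nat) (G : nat -> R -> R) (b : R)
    (c : 'rV[R]_n) (rs : seq (ridge R n)) (z0 : 'rV[R]_n)
    (hs : seq 'rV[R]_n) :
  (forall j (t : R), (j.+1 < p)%N -> is_derive t 1 (G j) (G j.+1 t)) ->
  (size hs < p)%N ->
  Dseq (ridge_op G b c rs z0) hs =
    affine_part b c z0 hs + ridge_sum G rs z0 hs.
Proof.
move=> DG; elim: hs => [//|h hs IH] /= hp.
rewrite IH ?(ltnW hp)//; apply/funext => z.
have D1 := is_diff_affine_part b c z0 z hs.
have D2 := is_diff_ridge_sum rs z0 z (fun t => DG _ t hp).
by have D := is_diffD D1 D2; rewrite (@diff_val _ _ _ _ _ _ _ D).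
Qed.

Lemma ridge_op_is_Ck (R : realType) (n p : nat) (G : nat -> R -> R) (b : R)
    (c : 'rV[R]_n) (rs : seq (ridge R n)) (z0 : 'rV[R]_n) :
  (0 < p)%N ->
  (forall j (t : R), (j.+1 < p)%N -> is_derive t 1 (G j) (G j.+1 t)) ->
  continuous (G p.-1) ->
  is_Ck p.-1 (ridge_op G b c rs z0).
Proof.
move=> p0 DG cG.
have D j (hs : j.-tuple 'rV[R]_n) : (j < p.-1)%N -> forall z,
    differentiable (fun y => Dn (ridge_op G b c rs z0) y hs) z.
  move=> jp z; have hsp : ((size hs).+1 < p)%N by rewrite size_tuple; lia.
  rewrite /Dn (Dseq_ridge_op b c rs z0 DG (ltnW hsp)).
  have D1 := is_diff_affine_part b c z0 z hs.
  have D2 := is_diff_ridge_sum rs z0 z (fun t => DG _ t hsp).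
  exact: (@ex_diff _ _ _ _ _ _ _ (is_diffD D1 D2)).
(* Below order [p.-1] continuity follows from differentiability; at order [p.-1] it comes from the
   continuity of [G p.-1]. *)
split=> // j hs; rewrite leq_eqVlt => /orP[/eqP jp|jp] z; last first.
  exact/differentiable_continuous/D.
have hsp : (size hs < p)%N by rewrite size_tuple; lia.
rewrite /Dn (Dseq_ridge_op b c rs z0 DG hsp).
apply: (@continuousD _ _ _ (affine_part b c z0 hs) (ridge_sum G rs z0 hs)).
  have D1 := is_diff_affine_part b c z0 z hs.
  by apply: differentiable_continuous.
elim: rs {D} => [|m rs IH].
  have -> : ridge_sum G [::] z0 hs = cst 0.
    by apply/funext => y; rewrite /ridge_sum big_nil.
  exact: cst_continuous.
have -> : ridge_sum G (m :: rs) z0 hs =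
    ( *:%R^~ ((\prod_(h <- hs) dotp m.1.1 h) *: m.2)) \o
      (G (size hs) \o (fun y => dotp m.1.1 (y - z0) - m.1.2)) +
    ridge_sum G rs z0 hs.
  by apply/funext => y; rewrite /ridge_sum big_cons /= -scalerA.
apply: continuousD; last exact: IH.
apply: (@continuous_comp _ _ _ (G (size hs) \o _)); last exact: scalel_continuous.
apply: continuous_comp.
  have D1 := is_diff_dotpB m.1.1 z0 z m.1.2.
  exact: differentiable_continuous.
rewrite size_tuple jp; exact: cG.
Qed.

(** * Lipschitz bound *)

Lemma sum_cauchy_schwarz (R : realType) (I : Type) (r : seq I) (s t : I -> R) :
  (\sum_(i <- r) s i * t i) ^+ 2 <=
    (\sum_(i <- r) s i ^+ 2) * (\sum_(i <- r) t i ^+ 2).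
Proof.
set S := \sum_(i <- r) s i * t i; set P := \sum_(i <- r) s i ^+ 2.
set Q := \sum_(i <- r) t i ^+ 2.
have Q0 : 0 <= Q by apply: sumr_ge0 => i _; exact: sqr_ge0.
have E (x y : R) : 0 <= x ^+ 2 * P - 2 * x * y * S + y ^+ 2 * Q.
  have -> : x ^+ 2 * P - 2 * x * y * S + y ^+ 2 * Q =
      \sum_(i <- r) (x * s i - y * t i) ^+ 2.
    rewrite !mulr_sumr -sumrB -big_split; apply: eq_bigr => i _ /=; ring.
  by apply: sumr_ge0 => i _; exact: sqr_ge0.
(* At [(Q, S)] the form [E] equals [Q * (P * Q - S ^+ 2)]. If [Q = 0], at [(S, P + 1)] it equals
   [- S ^+ 2 * (P + 2)], which forces [S = 0]. *)
have [Qp|] := ltP 0 Q.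
  have := E Q S; nra.
move=> Q0'; have Qz : Q = 0 by apply/eqP; rewrite eq_le Q0' Q0.
have := E S (P + 1); rewrite Qz; have := sqr_ge0 S.
have P0 : 0 <= P by apply: sumr_ge0 => i _; exact: sqr_ge0.
by rewrite !mulr0; nra.
Qed.

(** * Euclidean inner product *)

Lemma dotp_ge0 (R : realType) (n : nat) (u : 'rV[R]_n) : 0 <= dotp u u.
Proof. by apply: sumr_ge0 => i _; rewrite -expr2 sqr_ge0. Qed.

Lemma enorm_ge0 (R : realType) (n : nat) (u : 'rV[R]_n) : 0 <= enorm u.
Proof. exact: sqrtr_ge0. Qed.

Lemma sqr_enorm (R : realType) (n : nat) (u : 'rV[R]_n) :
  enorm u ^+ 2 = dotp u u.
Proof. by rewrite sqr_sqrtr ?dotp_ge0. Qed.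

Lemma dotp_le_enorm (R : realType) (n : nat) (u v : 'rV[R]_n) :
  dotp u v <= enorm u * enorm v.
Proof.
apply: le_trans (ler_norm _) _.
rewrite -(@ler_pXn2r _ 2) ?nnegrE ?mulr_ge0 ?enorm_ge0 ?normr_ge0//.
rewrite real_normK ?num_real// exprMn !sqr_enorm.
by have := sum_cauchy_schwarz (index_enum 'I_n) (u ord0) (v ord0).
Qed.

Lemma dotp_eq0 (R : realType) (n : nat) (u : 'rV[R]_n) :
  dotp u u = 0 -> u = 0.
Proof.
move=> /eqP; rewrite psumr_eq0 => [/allP H|i _]; last by rewrite -expr2 sqr_ge0.
apply/rowP => i; rewrite mxE; apply/eqP.
have /(_ i) := H _; rewrite mem_index_enum => /(_ isT) /=.
by rewrite mulf_eq0 orbb.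
Qed.

Lemma dotp_suml (R : realType) (n : nat) (I : Type) (r : seq I)
    (f : I -> 'rV[R]_n) (x : 'rV[R]_n) :
  dotp (\sum_(i <- r) f i) x = \sum_(i <- r) dotp (f i) x.
Proof. by rewrite dotpC linear_sum; apply: eq_bigr => i _; rewrite dotpC. Qed.

Lemma dotpZl (R : realType) (n : nat) (k : R) (u v : 'rV[R]_n) :
  dotp (k *: u) v = k * dotp u v.
Proof. by rewrite dotpC linearZ /= dotpC. Qed.

Lemma dotpZr (R : realType) (n : nat) (k : R) (u v : 'rV[R]_n) :
  dotp u (k *: v) = k * dotp u v.
Proof. by rewrite linearZ. Qed.

Lemma dotpDl (R : realType) (n : nat) (u v w : 'rV[R]_n) :
  dotp (u + v) w = dotp u w + dotp v w.
Proof. by rewrite dotpC linearD /= !(dotpC w). Qed.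

Lemma dotpBl (R : realType) (n : nat) (u v w : 'rV[R]_n) :
  dotp (u - v) w = dotp u w - dotp v w.
Proof. by rewrite dotpC linearB /= !(dotpC w). Qed.

(** The difference [V] of the two differentials is paired with itself. The [p.-1] unit directions
    contribute a factor [A] each, and Cauchy-Schwarz over the ridges bounds the remaining pairings
    with [z - z'] and [V]. The constant thus depends on the two frame bounds, not on the number of
    ridges. *)
Lemma lipschitz_ridge_op (R : realType) (n p : nat) (G : nat -> R -> R) (b : R)
    (c : 'rV[R]_n) (rs : seq (ridge R n)) (z0 : 'rV[R]_n) (M A B : R) :
  (1 < p)%N ->
  (forall j (t : R), (j.+1 < p)%N -> is_derive t 1 (G j) (G j.+1 t)) ->
  (forall s t, `|G p.-1 s - G p.-1 t| <= M * `|s - t|) ->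
  0 <= M -> 0 <= A -> 0 <= B ->
  (forall x, \sum_(m <- rs) dotp m.1.1 x ^+ 2 <= A ^+ 2 * dotp x x) ->
  (forall x, \sum_(m <- rs) dotp m.2 x ^+ 2 <= B ^+ 2 * dotp x x) ->
  lipschitz_order p (M * A ^+ p * B) (ridge_op G b c rs z0).
Proof.
move=> p1 DG LG M0 A0 B0 hA hB z z'.
apply: ub_ereal_sup => _ [hs hs1 <-]; rewrite lee_fin.
have hsp : (size hs < p)%N by rewrite size_tuple; lia.
rewrite /Dn (Dseq_ridge_op b c rs z0 DG hsp).
have -> : (affine_part b c z0 hs + ridge_sum G rs z0 hs) z -
    (affine_part b c z0 hs + ridge_sum G rs z0 hs) z' =
    ridge_sum G rs z0 hs z - ridge_sum G rs z0 hs z'.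
  (* Since [p >= 2], at least one differentiation has been made, and the differential of the affine
     part is constant. *)
  have aff : affine_part b c z0 hs z = affine_part b c z0 hs z'.
    by have := size_tuple hs; case: (tval hs) => [|h [|h' l]] //=; lia.
  rewrite -![(_ + _ : _ -> _) _]/(_ + _) aff opprD addrACA subrr add0r.
  by [].
have aA (m : ridge R n) x : m \in rs -> `|dotp m.1.1 x| <= A * enorm x.
  move=> mrs; rewrite -(@ler_pXn2r _ 2) ?nnegrE ?mulr_ge0 ?enorm_ge0 ?normr_ge0//.
  rewrite real_normK ?num_real// exprMn sqr_enorm; apply: le_trans (hA x).
  rewrite (big_rem m mrs) /= lerDl; apply: sumr_ge0 => i _; exact: sqr_ge0.
set V := _ - _.
have VE : V = \sum_(m <- rs) ((G p.-1 (dotp m.1.1 (z - z0) - m.1.2) -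
      G p.-1 (dotp m.1.1 (z' - z0) - m.1.2)) * \prod_(h <- hs) dotp m.1.1 h) *: m.2.
  rewrite /V /ridge_sum -sumrB; apply: eq_bigr => m _.
  by rewrite size_tuple -scalerBl -mulrBl.
set d := z - z'.
have VV : dotp V V <= M * A ^+ p.-1 * \sum_(m <- rs) `|dotp m.1.1 d| * `|dotp m.2 V|.
  rewrite {1}VE dotp_suml mulr_sumr big_seq [leRHS]big_seq.
  apply: ler_sum => m mrs; rewrite dotpZl.
  apply: le_trans (ler_norm _) _; rewrite !normrM mulrA ler_wpM2r//.
  have -> : M * A ^+ p.-1 * `|dotp m.1.1 d| = M * `|dotp m.1.1 d| * A ^+ p.-1 by ring.
  apply: ler_pM => //.
    apply: le_trans (LG _ _) _; rewrite ler_wpM2l//.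
    have -> : dotp m.1.1 (z - z0) - m.1.2 - (dotp m.1.1 (z' - z0) - m.1.2) = dotp m.1.1 d.
      by rewrite /d !linearB /=; ring.
    by [].
  have : all (fun h => enorm h <= 1) hs.
    apply/(all_nthP 0) => i; rewrite size_tuple => ip.
    by have := hs1 (Ordinal ip); rewrite (tnth_nth 0).
  move: (size_tuple hs); move: (tval hs) => l sl; rewrite -{}sl.
  elim: l => [|h l IH] /=; first by rewrite big_nil normr1.
  case/andP=> h1 /IH l1; rewrite big_cons normrM exprS; apply: ler_pM => //.
  by apply: le_trans (aA _ _ mrs) _; rewrite ler_piMr.
have S : \sum_(m <- rs) `|dotp m.1.1 d| * `|dotp m.2 V| <= A * enorm d * (B * enorm V).
  apply: le_trans (ler_norm _) _.
  rewrite -(@ler_pXn2r _ 2) ?nnegrE ?mulr_ge0 ?enorm_ge0 ?normr_ge0//.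
  rewrite real_normK ?num_real//; apply: le_trans (sum_cauchy_schwarz _ _ _) _.
  rewrite [leRHS]exprMn; apply: ler_pM.
  - by apply: sumr_ge0 => i _; exact: sqr_ge0.
  - by apply: sumr_ge0 => i _; exact: sqr_ge0.
  - rewrite exprMn sqr_enorm; under eq_bigr do rewrite real_normK ?num_real//.
    exact: hA.
  - rewrite exprMn sqr_enorm; under eq_bigr do rewrite real_normK ?num_real//.
    exact: hB.
have [V0|Vp] := leP (enorm V) 0.
  by apply: le_trans V0 _; rewrite !mulr_ge0 ?exprn_ge0 ?enorm_ge0.
rewrite -(ler_pM2r Vp) -expr2 sqr_enorm; apply: (le_trans VV).
have MA : 0 <= M * A ^+ p.-1 by rewrite mulr_ge0 ?exprn_ge0.
apply: le_trans (ler_wpM2l MA S) _.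
have {2}-> : p = p.-1.+1 by lia.
rewrite exprS le_eqVlt; apply/orP; left; apply/eqP; ring.
Qed.

(** The mean value theorem along a segment reduces monotonicity to a pointwise quadratic form in the
    slopes. A triple holds the increment of a ridge argument, its starting value, and the weight
    paired with the ridge. *)
Lemma ridge_increment_ge0 (R : realType) (g dg : R -> R)
    (l : seq (R * R * R)) :
  (forall t : R, is_derive t 1 g (dg t)) ->
  (forall s, 0 <= \sum_(m <- l) dg (m.1.1 * s + m.1.2) * m.1.1 * m.2) ->
  0 <= \sum_(m <- l) (g (m.1.1 + m.1.2) - g m.1.2) * m.2.
Proof.
move=> Dg H.
pose phi s := \sum_(m <- l) g (m.1.1 * s + m.1.2) * m.2.
have Dphi (s : R) : is_derive s 1 phi
    (\sum_(m <- l) dg (m.1.1 * s + m.1.2) * m.1.1 * m.2).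
  rewrite {H}/phi; elim: l => [|m l IH].
    rewrite big_nil (_ : (fun s => _) = cst 0); first exact: is_derive_cst.
    by apply/funext => y; rewrite big_nil.
  rewrite big_cons (_ : (fun s => _) = m.2 *: (g \o (m.1.1 *: id + cst m.1.2)) +
      (fun s => \sum_(m <- l) g (m.1.1 * s + m.1.2) * m.2)); last first.
    by apply/funext => y; rewrite big_cons mulrC.
  have D1 : is_derive s 1 (m.1.1 *: id + cst m.1.2 : R -> R) m.1.1.
    have D0 := is_deriveD (is_deriveZ m.1.1 (is_derive_id s 1)) (is_derive_cst m.1.2 s 1).
    by apply: (is_derive_eq D0); rewrite addr0; exact: mulr1.
  apply: (is_derive_eq (is_deriveD (is_deriveZ m.2 (is_derive1_comp (Dg _) D1)) IH)).
  by congr (_ + _); exact: mulrC.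
have [c _ ce] := MVT_all ler01 Dphi.
have -> : \sum_(m <- l) (g (m.1.1 + m.1.2) - g m.1.2) * m.2 = phi 1 - phi 0.
  rewrite /phi -sumrB; apply: eq_bigr => m _.
  by rewrite mulr1 mulr0 add0r mulrBl.
by rewrite ce subr0 mulr1.
Qed.

(** * Monotonicity of a link *)

(** Isolates what the chain needs from the spline: [g] is convex, flat up to 0, and of slope 1 from
    [T] on. *)
Record ramp (R : realType) (T : R) (g dg : R -> R) : Prop := Ramp {
  ramp_derive : forall t : R, is_derive t 1 g (dg t);
  ramp_T : 0 < T;
  ramp_ge0 : forall t, 0 <= dg t;
  ramp_le1 : forall t, dg t <= 1;
  ramp_mono : forall s t, s <= t -> dg s <= dg t;
  ramp_0 : forall t, t <= 0 -> dg t = 0;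
  ramp_1 : forall t, T <= t -> dg t = 1;
  ramp_g0 : forall t, t <= 0 -> g t = 0
}.

(* The coupling [d] is active only if [X > 4T] and [Y < 5T].  Then either
   [Y <= X / 4] and the last two ridges are saturated, or [X] and [Y] both lie
   in [[T, 20T]], where the two node frictions have slope 1. *)
Lemma link_form_half (R : realType) (T : R) (g dg : R -> R) (d X Y u v : R) :
  ramp T g dg -> Y <= X -> -1 <= d <= 1 ->
  (d = 0 \/ 4 * T < X /\ Y < 5 * T) ->
  0 <= d * (u * v) + (dg X - dg (X - 20 * T)) / 2 * u ^+ 2
     + (dg Y - dg (Y - 20 * T)) / 2 * v ^+ 2
     + 6 * dg (X - 2 * Y) * (u - 2 * v) ^+ 2
     + 6 * dg (X - 3 * Y) * (u - 3 * v) ^+ 2.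
Proof.
move=> [_ T0 g0 g1 gm z0 o1 _] YX /andP[d1 d2] dz.
have mX : 0 <= dg X - dg (X - 20 * T) by rewrite subr_ge0 gm//; lra.
have mY : 0 <= dg Y - dg (Y - 20 * T) by rewrite subr_ge0 gm//; lra.
have q1 := sqr_ge0 u; have q2 := sqr_ge0 v.
have q3 := sqr_ge0 (u - 2 * v); have q4 := sqr_ge0 (u - 3 * v).
have r1 : 0 <= (dg X - dg (X - 20 * T)) / 2 * u ^+ 2.
  by apply: mulr_ge0 => //; lra.
have r2 : 0 <= (dg Y - dg (Y - 20 * T)) / 2 * v ^+ 2.
  by apply: mulr_ge0 => //; lra.
have r3 : 0 <= 6 * dg (X - 2 * Y) * (u - 2 * v) ^+ 2.
  by apply: mulr_ge0 => //; apply: mulr_ge0.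
have r4 : 0 <= 6 * dg (X - 3 * Y) * (u - 3 * v) ^+ 2.
  by apply: mulr_ge0 => //; apply: mulr_ge0.
have [d0|[X4 Y5]] := dz; first by rewrite d0 mul0r; lra.
(* Two half frictions of slope 1 compensate exactly this lower bound. *)
have dl : - (u ^+ 2 + v ^+ 2) / 2 <= d * (u * v).
  have := sqr_ge0 (u + v); have := sqr_ge0 (u - v).
  have [uv|uv] := leP 0 (u * v).
    have : 0 <= (1 + d) * (u * v) by apply: mulr_ge0 => //; lra.
    by rewrite !expr2 => *; lra.
  have : 0 <= (1 - d) * - (u * v) by apply: mulr_ge0; lra.
  by rewrite !expr2 => *; lra.
have [Y4|Y4] := leP Y (X / 4).
  have : 0 <= d * (u * v) + 6 * (u - 2 * v) ^+ 2 + 6 * (u - 3 * v) ^+ 2.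
    (* For [d = -1] and [d = 1] the form is [12 u^2 - 61 u v + 78 v^2] and
       [12 u^2 - 59 u v + 78 v^2]; completing these squares leaves a positive multiple of [v^2]. *)
    have := sqr_ge0 (u - 61 / 24 * v); have := sqr_ge0 (u - 59 / 24 * v).
    move: q2; rewrite !expr2; have [uv|uv] := leP 0 (u * v).
      have : 0 <= (1 + d) * (u * v) by apply: mulr_ge0 => //; lra.
      by move=> *; lra.
    have : 0 <= (1 - d) * - (u * v) by apply: mulr_ge0; lra.
    by move=> *; lra.
  rewrite (o1 (X - 2 * Y)); last lra.
  rewrite (o1 (X - 3 * Y)); last lra.
  rewrite !mulr1; lra.
rewrite (o1 X) ?(o1 Y) ?(z0 (X - 20 * T)) ?(z0 (Y - 20 * T)); lra.
Qed.

(** By symmetry let [Y <= X]. The slopes at [X - 4T] and [Y - 4T] agree (both 0 or both 1) unless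
    [X > 4T] and [Y < 5T]. The shift [4T] gives [X - 3Y >= X / 4 > T] when [Y <= X / 4]; otherwise
    [X < 4Y < 20T], which explains the width [20T] of the friction. *)
Lemma link_form (R : realType) (T : R) (g dg : R -> R) (X Y u v : R) :
  ramp T g dg ->
  0 <= (dg (Y - 4 * T) - dg (X - 4 * T)) * (u * v)
     + (dg X - dg (X - 20 * T)) / 2 * u ^+ 2
     + (dg Y - dg (Y - 20 * T)) / 2 * v ^+ 2
     + 6 * dg (X - 2 * Y) * (u - 2 * v) ^+ 2
     + 6 * dg (X - 3 * Y) * (u - 3 * v) ^+ 2
     + 6 * dg (Y - 2 * X) * (v - 2 * u) ^+ 2
     + 6 * dg (Y - 3 * X) * (v - 3 * u) ^+ 2.
Proof.
move=> rg; have [_ T0 g0 g1 gm z0 o1 _] := rg.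
set d := dg (Y - 4 * T) - dg (X - 4 * T).
have d1 : -1 <= d <= 1.
  have := (g0 (Y - 4 * T), g1 (Y - 4 * T)); have := (g0 (X - 4 * T), g1 (X - 4 * T)).
  by rewrite /d => -[? ?] [? ?]; lra.
have P a b : 0 <= 6 * dg a * b ^+ 2.
  by apply: mulr_ge0 (sqr_ge0 b); apply: mulr_ge0.
have [YX|XY] := leP Y X.
  have : d = 0 \/ 4 * T < X /\ Y < 5 * T.
    rewrite /d; have [X4|X4] := leP X (4 * T).
      by left; rewrite !z0 ?subrr; lra.
    have [Y5|Y5] := leP (5 * T) Y; last by right.
    by left; rewrite !o1 ?subrr; lra.
  move=> /(link_form_half u v rg YX d1).
  have := P (Y - 2 * X) (v - 2 * u); have := P (Y - 3 * X) (v - 3 * u); lra.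
have : d = 0 \/ 4 * T < Y /\ X < 5 * T.
  rewrite /d; have [X4|X4] := leP Y (4 * T).
    by left; rewrite !z0 ?subrr; lra.
  have [Y5|Y5] := leP (5 * T) X; last by right.
  by left; rewrite !o1 ?subrr; lra.
move=> /(link_form_half v u rg (ltW XY) d1); rewrite (mulrC v u).
have := P (X - 2 * Y) (u - 2 * v); have := P (X - 3 * Y) (u - 3 * v); lra.
Qed.

(** Integrated form of [link_form]. The frictions carry the weight 1/2 because an interior node
    shares its friction between two links. *)
Lemma link_monotone (R : realType) (T : R) (g dg : R -> R) (x y x' y' : R) :
  ramp T g dg ->
  0 <= (g (y - 4 * T) - g (y' - 4 * T)) * (x - x')
     - (g (x - 4 * T) - g (x' - 4 * T)) * (y - y')
     + (g x - g (x - 20 * T) - (g x' - g (x' - 20 * T))) / 2 * (x - x')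
     + (g y - g (y - 20 * T) - (g y' - g (y' - 20 * T))) / 2 * (y - y')
     + 6 * (g (x - 2 * y) - g (x' - 2 * y')) * (x - x' - 2 * (y - y'))
     + 6 * (g (x - 3 * y) - g (x' - 3 * y')) * (x - x' - 3 * (y - y'))
     + 6 * (g (y - 2 * x) - g (y' - 2 * x')) * (y - y' - 2 * (x - x'))
     + 6 * (g (y - 3 * x) - g (y' - 3 * x')) * (y - y' - 3 * (x - x')).
Proof.
move=> rg; set u := x - x'; set v := y - y'.
(* The first two entries are the skew coupling; their derivatives combine into the cross term in
   [u * v] of [link_form]. *)
pose l := [:: (v, y' - 4 * T, u); (u, x' - 4 * T, - v);
  (u, x', u / 2); (u, x' - 20 * T, - u / 2);
  (v, y', v / 2); (v, y' - 20 * T, - v / 2);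
  (u - 2 * v, x' - 2 * y', 6 * (u - 2 * v));
  (u - 3 * v, x' - 3 * y', 6 * (u - 3 * v));
  (v - 2 * u, y' - 2 * x', 6 * (v - 2 * u));
  (v - 3 * u, y' - 3 * x', 6 * (v - 3 * u))].
have form s : 0 <= \sum_(m <- l) dg (m.1.1 * s + m.1.2) * m.1.1 * m.2.
  rewrite /l !big_cons big_nil /=.
  have := link_form (u * s + x') (v * s + y') u v rg.
  have F1 t : u * s + (x' - t) = u * s + x' - t by ring.
  have F2 t : v * s + (y' - t) = v * s + y' - t by ring.
  have F3 t : (u - t * v) * s + (x' - t * y') = u * s + x' - t * (v * s + y') by ring.
  have F4 t : (v - t * u) * s + (y' - t * x') = v * s + y' - t * (u * s + x') by ring.
  rewrite !(F1, F2, F3, F4).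
  by move/le_trans; apply; rewrite le_eqVlt; apply/orP; left; apply/eqP; ring.
have H := ridge_increment_ge0 (ramp_derive rg) form.
rewrite /l !big_cons big_nil /= in H.
have E1 : u + x' = x by rewrite /u; ring.
have E2 : v + y' = y by rewrite /v; ring.
have E3 t : u + (x' - t) = x - t by rewrite /u; ring.
have E4 t : v + (y' - t) = y - t by rewrite /v; ring.
have E5 t : u - t * v + (x' - t * y') = x - t * y by rewrite /u /v; ring.
have E6 t : v - t * u + (y' - t * x') = y - t * x by rewrite /u /v; ring.
rewrite !(E1, E2, E3, E4, E5, E6) in H.
by apply: le_trans H _; rewrite le_eqVlt; apply/orP; left; apply/eqP; ring.
Qed.

(** * The chain operator *)

(* Together the two ridges give the bounded friction
   [f (g(w) - g(w - 20T))], constant equal to [20 T f] for [w >= 21T]. *)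
Definition friction_ridges (R : realType) (n : nat) (T f : R) (u : 'rV[R]_n) :
    seq (ridge R n) :=
  [:: (u, 0, f *: u); (u, 20 * T, - f *: u)].

(* The first two ridges are the skew coupling; the others are gradients of
   convex ridges, inactive on the cone [x <= 2y], [y <= 2x] around the diagonal
   that contains the pairs of neighbouring coordinates of the zero. *)
Definition link_ridges (R : realType) (n : nat) (T : R) (u v : 'rV[R]_n) :
    seq (ridge R n) :=
  [:: (v, 4 * T, u); (u, 4 * T, - v);
      (u - 2 *: v, 0, 6 *: (u - 2 *: v)); (u - 3 *: v, 0, 6 *: (u - 3 *: v));
      (v - 2 *: u, 0, 6 *: (v - 2 *: u)); (v - 3 *: u, 0, 6 *: (v - 3 *: u))].

(* The last ridge absorbs the flow at the end of the chain. *)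
Definition chain_ridges (R : realType) (n : nat) (T : R) (f : nat -> R)
    (l : nat) (e : nat -> 'rV[R]_n) : seq (ridge R n) :=
  flatten [seq friction_ridges T (f i) (e i) | i <- iota 0 l.+1] ++
  flatten [seq link_ridges T (e i) (e i.+1) | i <- iota 0 l] ++
  [:: (e l, 4 * T, e l)].

Definition scale_ridge (R : realType) (n : nat) (r k : R) (m : ridge R n) :
    ridge R n :=
  (r *: m.1.1, m.1.2, k *: m.2).

(** A unit-scale operator evaluated at [r (z - z0)] and multiplied by [k], whence the linear
    coefficient [k * mu * r]. The constant along [e 0] is the source that drives the flow through
    the chain. *)
Definition chain_op (R : realType) (n : nat) (G : nat -> R -> R) (T : R)
    (f : nat -> R) (l : nat) (r k b mu : R) (z0 : 'rV[R]_n)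
    (e : nat -> 'rV[R]_n) : 'rV[R]_n -> 'rV[R]_n :=
  ridge_op G (k * mu * r) (- (k * b) *: e 0%N)
    [seq scale_ridge r k m | m <- chain_ridges T f l e] z0.

Lemma big_chain (R : realType) (n : nat) (V : nmodType) (T : R) (f : nat -> R)
    (l : nat) (r k : R) (e : nat -> 'rV[R]_n) (Phi : ridge R n -> V) :
  \sum_(m <- [seq scale_ridge r k m | m <- chain_ridges T f l e]) Phi m =
  \sum_(i < l.+1)
    \sum_(m <- friction_ridges T (f i) (e i)) Phi (scale_ridge r k m) +
  (\sum_(i < l)
    \sum_(m <- link_ridges T (e i) (e i.+1)) Phi (scale_ridge r k m) +
  Phi (scale_ridge r k (e l, 4 * T, e l))).
Proof.
have E (m : nat) (h : nat -> seq (ridge R n)) (F : ridge R n -> V) :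
    \sum_(x <- flatten [seq h i | i <- iota 0 m]) F x =
    \sum_(i < m) \sum_(x <- h i) F x.
  rewrite big_flatten big_map -(big_mkord xpredT (fun i => \sum_(x <- h i) F x)).
  by rewrite /index_iota subn0.
by rewrite big_map /chain_ridges big_cat E big_cat E big_seq1.
Qed.

(** Each node belongs to at most two links. *)
Lemma sum_adjacent_le (R : realType) (q : nat -> R) (l : nat) :
  (forall i, 0 <= q i) ->
  \sum_(i < l) (q i + q i.+1) <= 2 * \sum_(i < l.+1) q i.
Proof.
move=> q0; rewrite big_split /= mulr_natl mulr2n lerD//.
  by rewrite big_ord_recr /= lerDl.
by rewrite [leRHS]big_ord_recl /= lerDr.
Qed.

Lemma parseval (R : realType) (n l : nat) (e : nat -> 'rV[R]_n) (c : nat -> R) :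
  (forall i j, (i < l)%N -> (j < l)%N -> dotp (e i) (e j) = (i == j)%:R) ->
  dotp (\sum_(i < l) c i *: e i) (\sum_(i < l) c i *: e i) = \sum_(i < l) c i ^+ 2.
Proof.
move=> he; rewrite dotp_suml; apply: eq_bigr => i _; rewrite dotpZl expr2; congr (_ * _).
rewrite linear_sum (bigD1 i) //= dotpZr he// eqxx mulr1 big1 ?addr0// => j ji.
by rewrite dotpZr he// eq_sym (inj_eq val_inj) (negbTE ji) mulr0.
Qed.

Lemma bessel (R : realType) (n l : nat) (e : nat -> 'rV[R]_n) (x : 'rV[R]_n) :
  (forall i j, (i < l)%N -> (j < l)%N -> dotp (e i) (e j) = (i == j)%:R) ->
  \sum_(i < l) dotp (e i) x ^+ 2 <= dotp x x.
Proof.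
move=> he; set y := \sum_(i < l) dotp (e i) x *: e i.
have yx : dotp y x = \sum_(i < l) dotp (e i) x ^+ 2.
  by rewrite dotp_suml; apply: eq_bigr => i _; rewrite dotpZl expr2.
have yy := parseval (fun i => dotp (e i) x) he; rewrite -/y in yy.
have := dotp_ge0 (x - y); rewrite dotpBl !linearB /= (dotpC x y) yy yx.
by lra.
Qed.

(** Every ridge involves at most two neighbouring frame vectors, so Bessel's inequality with bounded
    overlap gives constants independent of [l]. *)
Lemma chain_bessel (R : realType) (n : nat) (T : R) (f : nat -> R) (l : nat)
    (r k : R) (e : nat -> 'rV[R]_n) (x : 'rV[R]_n) :
  (forall i, (i <= l)%N -> 0 <= f i <= 4) ->
  (forall i j, (i < l.+1)%N -> (j < l.+1)%N -> dotp (e i) (e j) = (i == j)%:R) ->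
  let rs := [seq scale_ridge r k m | m <- chain_ridges T f l e] in
  \sum_(m <- rs) dotp m.1.1 x ^+ 2 <= (100 * r) ^+ 2 * dotp x x /\
  \sum_(m <- rs) dotp m.2 x ^+ 2 <= (100 * k) ^+ 2 * dotp x x.
Proof.
move=> f4 he rs; have Be := bessel x he.
pose q i := dotp (e i) x ^+ 2.
have q0 i : 0 <= q i by exact: sqr_ge0.
have S1 := sum_adjacent_le l q0.
have S2 : q l <= \sum_(i < l.+1) q i.
  by rewrite big_ord_recr /= lerDr; apply: sumr_ge0.
set S := \sum_(i < l.+1) q i in S1 S2.
have SB : S <= dotp x x by [].
have S0 : 0 <= S by apply: sumr_ge0.
have bnd (c A B : R) (X Y : nat -> R) :
    (forall i, (i <= l)%N -> X i <= c ^+ 2 * (A * q i)) ->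
    (forall i, (i < l)%N -> Y i <= c ^+ 2 * (B * (q i + q i.+1))) ->
    0 <= A -> 0 <= B -> A + 2 * B + 1 <= 10000 ->
    \sum_(i < l.+1) X i + (\sum_(i < l) Y i + c ^+ 2 * q l) <=
    (100 * c) ^+ 2 * dotp x x.
  move=> HX HY A0 B0 AB.
  have X1 : \sum_(i < l.+1) X i <= c ^+ 2 * (A * S).
    rewrite /S !mulr_sumr; apply: ler_sum => i _; apply: HX.
    by rewrite -ltnS.
  have Y1 : \sum_(i < l) Y i <= c ^+ 2 * (B * (2 * S)).
    apply: (@le_trans _ _ (c ^+ 2 * (B * \sum_(i < l) (q i + q i.+1)))).
      by rewrite !mulr_sumr; apply: ler_sum => i _; apply: HY.
    by rewrite ler_wpM2l ?sqr_ge0// ler_wpM2l.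
  have Z1 : c ^+ 2 * q l <= c ^+ 2 * S by rewrite ler_wpM2l ?sqr_ge0.
  apply: (@le_trans _ _ (c ^+ 2 * ((A + 2 * B + 1) * S))).
    have -> : c ^+ 2 * ((A + 2 * B + 1) * S) =
      c ^+ 2 * (A * S) + (c ^+ 2 * (B * (2 * S)) + c ^+ 2 * S) by ring.
    by rewrite !lerD.
  have -> : (100 * c) ^+ 2 * dotp x x = c ^+ 2 * (10000 * dotp x x) by ring.
  rewrite ler_wpM2l ?sqr_ge0//.
  by apply: ler_pM => //; lra.
split; rewrite /rs big_chain /=.
  pose Phi (m : ridge R n) := dotp (scale_ridge r k m).1.1 x ^+ 2.
  (* Two friction ridges per node give 2; the six link directions give [1 + 5 + 10 + 5 + 10 = 31],
     as [(a - c b)^2 <= (1 + c^2) (a^2 + b^2)]. *)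
  rewrite dotpZl exprMn; apply: (bnd r 2 31
    (fun i => \sum_(m <- friction_ridges T (f i) (e i)) Phi m)
    (fun i => \sum_(m <- link_ridges T (e i) (e i.+1)) Phi m));
    rewrite ?/Phi; [| | lra | lra | lra].
  - move=> i _; rewrite /friction_ridges !big_cons big_nil /= !dotpZl /q; lra.
  - move=> i _; rewrite /link_ridges !big_cons big_nil /= !dotpZl !dotpBl !dotpZl /q.
    set b := dotp (e i.+1) x; set a := dotp (e i) x.
    have H : b ^+ 2 + a ^+ 2 + (a - 2 * b) ^+ 2 + (a - 3 * b) ^+ 2 +
        (b - 2 * a) ^+ 2 + (b - 3 * a) ^+ 2 <= 31 * (a ^+ 2 + b ^+ 2).
      have := sqr_ge0 (2 * a + b); have := sqr_ge0 (a + 2 * b).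
      have := sqr_ge0 (3 * a + b); have := sqr_ge0 (a + 3 * b).
      by rewrite !expr2 => *; lra.
    apply: le_trans _ (ler_wpM2l (sqr_ge0 r) H).
    by rewrite le_eqVlt; apply/orP; left; apply/eqP; ring.
pose Phi (m : ridge R n) := dotp (scale_ridge r k m).2 x ^+ 2.
(* Here [32 = 2 * 4^2] from [f i <= 4], and [1081 = 1 + 36 * 30] from the weights 6. *)
rewrite dotpZl exprMn; apply: (bnd k 32 1081
  (fun i => \sum_(m <- friction_ridges T (f i) (e i)) Phi m)
  (fun i => \sum_(m <- link_ridges T (e i) (e i.+1)) Phi m));
    rewrite ?/Phi; [| | lra | lra | lra].
- move=> i /f4/andP[f0 f4']; rewrite /friction_ridges !big_cons big_nil /= !dotpZl /q.
  have : f i ^+ 2 <= 16 by rewrite expr2; nra.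
  move=> ff; rewrite !exprMn sqrrN addr0 -mulrDr ler_wpM2l ?sqr_ge0//.
  by rewrite -mulrDl ler_wpM2r ?sqr_ge0//; lra.
move=> i _; rewrite /link_ridges !big_cons big_nil /= !dotpZl.
rewrite -[- e i.+1]scaleN1r !dotpBl !dotpZl /q.
set b := dotp (e i.+1) x; set a := dotp (e i) x.
have H : b ^+ 2 + a ^+ 2 + 36 * ((a - 2 * b) ^+ 2 + (a - 3 * b) ^+ 2 +
    (b - 2 * a) ^+ 2 + (b - 3 * a) ^+ 2) <= 1081 * (a ^+ 2 + b ^+ 2).
  have := sqr_ge0 (2 * a + b); have := sqr_ge0 (a + 2 * b).
  have := sqr_ge0 (3 * a + b); have := sqr_ge0 (a + 3 * b).
  by rewrite !expr2 => *; lra.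
apply: le_trans _ (ler_wpM2l (sqr_ge0 k) H).
by rewrite le_eqVlt; apply/orP; left; apply/eqP; ring.
Qed.

(** * Monotonicity of the chain *)

Lemma dotp_ridge_opB (R : realType) (n : nat) (G : nat -> R -> R) (b : R)
    (c : 'rV[R]_n) (rs : seq (ridge R n)) (z0 z z' d : 'rV[R]_n) :
  dotp (ridge_op G b c rs z0 z - ridge_op G b c rs z0 z') d =
  b * dotp (z - z') d +
  \sum_(m <- rs) (G 0%N (dotp m.1.1 (z - z0) - m.1.2) -
                  G 0%N (dotp m.1.1 (z' - z0) - m.1.2)) * dotp m.2 d.
Proof.
have zz : dotp (z - z') d = dotp (z - z0) d - dotp (z' - z0) d.
  by rewrite -dotpBl; congr dotp; rewrite opprB addrA subrK.
rewrite dotpBl {}zz; set D := dotp (z - z0) d; set D' := dotp (z' - z0) d.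
rewrite /ridge_op /= !(dotpDl _ _ d) !(dotpZl b) /ridge_sum !dotp_suml -/D -/D'.
have -> : \sum_(m <- rs) (G 0%N (dotp m.1.1 (z - z0) - m.1.2) -
                  G 0%N (dotp m.1.1 (z' - z0) - m.1.2)) * dotp m.2 d =
    \sum_(m <- rs) G 0%N (dotp m.1.1 (z - z0) - m.1.2) * dotp m.2 d -
    \sum_(m <- rs) G 0%N (dotp m.1.1 (z' - z0) - m.1.2) * dotp m.2 d.
  by rewrite -sumrB; apply: eq_bigr => m _; rewrite mulrBl.
under eq_bigr do rewrite big_nil mulr1 dotpZl.
under [X in _ - (_ + X)]eq_bigr do rewrite big_nil mulr1 dotpZl.
ring.
Qed.

(** The negative part of each link is paid by half the frictions of its two ends. Summing over the
    chain uses each friction at most once, which [1 <= f i] affords; the linear term and the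
    absorbing ridge at the last node are left over. *)
Lemma chain_op_monotone (R : realType) (n : nat) (G : nat -> R -> R) (T : R)
    (dg : R -> R) (f : nat -> R) (l : nat) (r k b mu : R) (z0 z z' : 'rV[R]_n)
    (e : nat -> 'rV[R]_n) :
  ramp T (G 0%N) dg -> 0 < r -> 0 <= k ->
  (forall i, (i <= l)%N -> 1 <= f i) ->
  let w := r * dotp (e l) (z - z0) in
  let w' := r * dotp (e l) (z' - z0) in
  k * mu * r * dotp (z - z') (z - z') +
  k / r * ((G 0%N (w - 4 * T) - G 0%N (w' - 4 * T)) * (w - w')) <=
  dotp (chain_op G T f l r k b mu z0 e z - chain_op G T f l r k b mu z0 e z')
       (z - z').
Proof.
move=> rg r0 k0 f1 /=; set w := r * dotp (e l) (z - z0).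
set w' := r * dotp (e l) (z' - z0); set d := z - z'; set g := G 0%N in rg *.
pose W i := r * dotp (e i) (z - z0); pose W' i := r * dotp (e i) (z' - z0).
have Ed i : dotp (e i) d = r^-1 * (W i - W' i).
  rewrite /W /W' -mulrBr mulrA mulVf ?gt_eqF// mul1r -linearB /=; congr dotp.
  by rewrite /d opprB addrA subrK.
pose Q i := (g (W i) - g (W i - 20 * T) - (g (W' i) - g (W' i - 20 * T))) *
  (W i - W' i).
(* [g(w) - g(w - 20T)] is nondecreasing in [w] because [dg] is. *)
have Q0 i : 0 <= Q i.
  have T0 := ramp_T rg; pose v := W i - W' i.
  have := @ridge_increment_ge0 _ g dg [:: (v, W' i, v); (v, W' i - 20 * T, - v)]
    (ramp_derive rg).
  rewrite !big_cons big_nil /=.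
  have -> : v + W' i = W i by rewrite /v; ring.
  have -> : v + (W' i - 20 * T) = W i - 20 * T by rewrite /v; ring.
  have -> : (g (W i) - g (W' i)) * v +
    ((g (W i - 20 * T) - g (W' i - 20 * T)) * - v + 0) = Q i by rewrite /Q /v; ring.
  apply=> s; rewrite !big_cons big_nil /=.
  have -> : dg (v * s + W' i) * v * v + (dg (v * s + (W' i - 20 * T)) * v * - v + 0) =
    (dg (v * s + W' i) - dg (v * s + (W' i - 20 * T))) * v ^+ 2 by ring.
  by rewrite mulr_ge0 ?sqr_ge0// subr_ge0; apply: (ramp_mono rg); lra.
pose L i := (g (W i.+1 - 4 * T) - g (W' i.+1 - 4 * T)) * (W i - W' i)
     - (g (W i - 4 * T) - g (W' i - 4 * T)) * (W i.+1 - W' i.+1)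
     + 6 * (g (W i - 2 * W i.+1) - g (W' i - 2 * W' i.+1)) * (W i - W' i - 2 * (W i.+1 - W' i.+1))
     + 6 * (g (W i - 3 * W i.+1) - g (W' i - 3 * W' i.+1)) * (W i - W' i - 3 * (W i.+1 - W' i.+1))
     + 6 * (g (W i.+1 - 2 * W i) - g (W' i.+1 - 2 * W' i)) * (W i.+1 - W' i.+1 - 2 * (W i - W' i))
     + 6 * (g (W i.+1 - 3 * W i) - g (W' i.+1 - 3 * W' i)) * (W i.+1 - W' i.+1 - 3 * (W i - W' i)).
have QL i : - L i <= 2^-1 * (Q i + Q i.+1).
  have H := link_monotone (W i) (W i.+1) (W' i) (W' i.+1) rg.
  rewrite -subr_ge0; apply: le_trans H _.
  by rewrite le_eqVlt; apply/orP; left; apply/eqP; rewrite /Q /L; field.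
rewrite /chain_op dotp_ridge_opB -/g lerD2l big_chain.
have -> : \sum_(i < l.+1) \sum_(m <- friction_ridges T (f i) (e i))
    (g (dotp (scale_ridge r k m).1.1 (z - z0) - (scale_ridge r k m).1.2) -
     g (dotp (scale_ridge r k m).1.1 (z' - z0) - (scale_ridge r k m).1.2)) *
     dotp (scale_ridge r k m).2 d = k / r * \sum_(i < l.+1) f i * Q i.
  rewrite mulr_sumr; apply: eq_bigr => i _.
  rewrite /friction_ridges !big_cons big_nil /= !dotpZl -/(W i) -/(W' i) Ed !subr0 /Q.
  ring.
have -> : \sum_(i < l) \sum_(m <- link_ridges T (e i) (e i.+1))
    (g (dotp (scale_ridge r k m).1.1 (z - z0) - (scale_ridge r k m).1.2) -
     g (dotp (scale_ridge r k m).1.1 (z' - z0) - (scale_ridge r k m).1.2)) *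
     dotp (scale_ridge r k m).2 d = k / r * \sum_(i < l) L i.
  rewrite mulr_sumr; apply: eq_bigr => i _.
  rewrite /link_ridges !big_cons big_nil /= -[- e i.+1]scaleN1r.
  rewrite !dotpZl !dotpBl !dotpZl !mulrBr ![r * (_ * _)]mulrCA.
  rewrite -!/(W _) -!/(W' _) !Ed !subr0 /L.
  ring.
rewrite /= !dotpZl -/w -/w' Ed /W /W' -/w -/w'.
have -> : (g (w - 4 * T) - g (w' - 4 * T)) * (k * (r^-1 * (w - w'))) =
    k / r * ((g (w - 4 * T) - g (w' - 4 * T)) * (w - w')) by ring.
rewrite addrA lerDr -mulrDr mulr_ge0 ?divr_ge0 ?(ltW r0)//.
have S1 : \sum_(i < l) - L i <= 2^-1 * \sum_(i < l) (Q i + Q i.+1).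
  by rewrite mulr_sumr; apply: ler_sum.
have S2 := sum_adjacent_le l Q0.
have S3 : \sum_(i < l.+1) Q i <= \sum_(i < l.+1) f i * Q i.
  by apply: ler_sum => i _; rewrite ler_peMl// f1// -ltnS.
by rewrite sumrN in S1; lra.
Qed.

(** * The zero of the chain *)

Lemma ramp_affine (R : realType) (T : R) (g dg : R -> R) (s t : R) :
  ramp T g dg -> T <= s -> s <= t -> g t - g s = t - s.
Proof.
move=> rg Ts st; have [c] := MVT_all st (ramp_derive rg).
rewrite in_itv /= => /andP[sc _] ->; rewrite (ramp_1 rg) ?mul1r//; lra.
Qed.

(** Where all coordinates are at least [21 T] and neighbours differ by a factor at most 2, frictions
    are constant, cone ridges vanish and couplings are affine of slope 1. The equation becomes a
    linear recurrence along the chain, and [b] is the source that balances node 0. *)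
Lemma chain_op_zero (R : realType) (n : nat) (G : nat -> R -> R) (T : R)
    (dg : R -> R) (f W : nat -> R) (l : nat) (r k mu : R) (z0 : 'rV[R]_n)
    (e : nat -> 'rV[R]_n) :
  ramp T (G 0%N) dg -> 0 < r ->
  (forall i j, (i < l.+2)%N -> (j < l.+2)%N -> dotp (e i) (e j) = (i == j)%:R) ->
  (forall i, (i <= l.+1)%N -> 21 * T <= W i) ->
  (forall i, (i <= l)%N -> W i <= 2 * W i.+1 /\ W i.+1 <= 2 * W i) ->
  (forall i, (i < l)%N -> f i.+1 * (20 * T) + mu * W i.+1 + W i.+2 - W i = 0) ->
  f l.+1 * (20 * T) + mu * W l.+1 + W l.+1 - W l = 0 ->
  let b := f 0%N * (20 * T) + mu * W 0%N + G 0%N (W 1%N - 4 * T) in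
  chain_op G T f l.+1 r k b mu z0 e
    (z0 + \sum_(i < l.+2) (r^-1 * W i) *: e i) = 0.
Proof.
move=> rg r0 he WT W2 fW fl b; set g := G 0%N in rg b *.
have T0 := ramp_T rg.
set zs := z0 + _; have zE : zs - z0 = \sum_(i < l.+2) (r^-1 * W i) *: e i.
  by rewrite /zs addrC addKr.
have dW i : (i < l.+2)%N -> r * dotp (e i) (zs - z0) = W i.
  move=> il; rewrite zE linear_sum (bigD1 (Ordinal il)) //= dotpZr he// eqxx mulr1.
  rewrite big1 ?addr0 ?mulrA ?mulfV ?gt_eqF ?mul1r// => j ji.
  rewrite dotpZr he// (_ : i == j = false) ?mulr0//.
  by apply/negP => /eqP ij; move/eqP: ji; apply; exact/val_inj.
pose h i := g (W i - 4 * T).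
have hB i j : (i < l.+2)%N -> (j < l.+2)%N -> h i - h j = W i - W j.
  move=> il jl; have WTi := WT i il; have WTj := WT j jl; rewrite /h.
  have [ij|/ltW ij] := leP (W j) (W i).
    rewrite (ramp_affine rg); first (by ring); lra.
  have := @ramp_affine _ _ _ _ (W i - 4 * T) (W j - 4 * T) rg; lra.
rewrite /chain_op /ridge_op /ridge_sum big_chain /=.
under eq_bigr => i _ do under eq_bigr => m _ do rewrite big_nil mulr1.
under [X in _ + (_ + (X + _))]eq_bigr => i _ do under eq_bigr => m _ do rewrite big_nil mulr1.
rewrite big_nil mulr1 dotpZl dW//.
have -> : \sum_(i < l.+2) \sum_(m <- friction_ridges T (f i) (e i))
    g (dotp (scale_ridge r k m).1.1 (zs - z0) - (scale_ridge r k m).1.2) *: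
      (scale_ridge r k m).2 = k *: \sum_(i < l.+2) (f i * (20 * T)) *: e i.
  rewrite scaler_sumr; apply: eq_bigr => i _.
  rewrite /friction_ridges !big_cons big_nil /= !dotpZl dW// !subr0 addr0 !scalerA -scalerDl.
  congr (_ *: _).
  have := @ramp_affine _ _ _ _ (W i - 20 * T) (W i) rg.
  have := WT i; rewrite -ltnS ltn_ord => /(_ isT) Wi.
  have -> : W i - (W i - 20 * T) = 20 * T by ring.
  move=> E; transitivity (k * f i * (g (W i) - g (W i - 20 * T))); first by ring.
  by rewrite E; [ring | lra | lra].
have -> : \sum_(i < l.+1) \sum_(m <- link_ridges T (e i) (e i.+1))
    g (dotp (scale_ridge r k m).1.1 (zs - z0) - (scale_ridge r k m).1.2) *:
      (scale_ridge r k m).2 =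
    k *: (\sum_(i < l.+1) h i.+1 *: e i - \sum_(i < l.+1) h i *: e i.+1).
  rewrite scalerBr !scaler_sumr -sumrB; apply: eq_bigr => i _.
  have il : (i < l.+2)%N by rewrite ltnW// ltnS.
  have il1 : (i.+1 < l.+2)%N by rewrite ltnS.
  have [W2a W2b] := W2 i (ltn_ord i).
  have Wi := WT i il; have Wi1 := WT i.+1 il1.
  rewrite /link_ridges !big_cons big_nil /= !dotpZl -[- e i.+1]scaleN1r.
  rewrite !dotpBl !dotpZl !mulrBr ![r * (_ * _)]mulrCA !dW//.
  have z1 : W i - 2 * W i.+1 - 0 <= 0 by lra.
  have z2 : W i - 3 * W i.+1 - 0 <= 0 by lra.
  have z3 : W i.+1 - 2 * W i - 0 <= 0 by lra.
  have z4 : W i.+1 - 3 * W i - 0 <= 0 by lra.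
  rewrite (ramp_g0 rg z1) (ramp_g0 rg z2) (ramp_g0 rg z3) (ramp_g0 rg z4).
  rewrite !scale0r !addr0.
  by rewrite !scalerA -/(h i.+1) -/(h i) -scaleNr; congr (_ *: _ + _ *: _); ring.
have -> : - (k * b) *: e 0%N + k * mu * r *: (zs - z0) =
    k *: (- b *: e 0%N + \sum_(i < l.+2) (mu * W i) *: e i).
  rewrite zE scalerDr scalerA mulrN; congr (_ + _).
  rewrite !scaler_sumr; apply: eq_bigr => i _; rewrite !scalerA; congr (_ *: _).
  by field; rewrite gt_eqF.
rewrite -/g -/(h l.+1) scalerA (mulrC _ k) -scalerA -!scalerDr.
apply/eqP; rewrite scaler_eq0; apply/orP; right; apply/eqP.
(* The source is treated as the inflow into node 0 and the absorbing ridge as the outflow of the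
   last node, so that one formula serves all nodes. *)
pose prev i := if i is j.+1 then h j else b.
pose next i := if i == l.+1 then h l.+1 else h i.+1.
have -> : \sum_(i < l.+1) h i.+1 *: e i = \sum_(i < l.+2) next i *: e i - h l.+1 *: e l.+1.
  rewrite [X in X - _]big_ord_recr /= /next eqxx addrK; apply: eq_bigr => i _.
  by rewrite ltn_eqF.
have -> : \sum_(i < l.+1) h i *: e i.+1 = \sum_(i < l.+2) prev i *: e i - b *: e 0%N.
  by rewrite [X in X - _]big_ord_recl /= addrAC subrr add0r.
have Z : \sum_(i < l.+2) (f i * (20 * T) + mu * W i + next i - prev i) *: e i = 0.
  apply: big1 => i _; rewrite (_ : (_ - _) = 0) ?scale0r//.
  case: i => [] [|i] il /=.
    by rewrite /prev /next /b /h /=; ring.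
  rewrite /next /prev /=; case: eqP => [[->]|/eqP il1].
    by rewrite -addrA hB// addrA.
  by rewrite -addrA hB// ?addrA ?fW//; lia.
rewrite -[RHS]Z; under [RHS]eq_bigr => i _ do rewrite scalerBl !scalerDl.
rewrite sumrB !big_split /=.
move: (\sum_(i < l.+2) (f i * (20 * T)) *: e i) => S1.
move: (\sum_(i < l.+2) (mu * W i) *: e i) => S2.
move: (\sum_(i < l.+2) next i *: e i) => S3.
move: (\sum_(i < l.+2) prev i *: e i) => S4.
rewrite scaleNr; move: (b *: e 0%N) (h l.+1 *: e l.+1) => x y.
apply/rowP => j; rewrite !mxE; ring.
Qed.

(** * Resisting oracle *)

(* Ridges built on coordinates that vanish at [z] have an argument [<= 0], where
   [g] is flat, so they do not show up in the oracle output. *)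
Lemma oracle_chain_op_eq (R : realType) (n p : nat) (G : nat -> R -> R) (T : R)
    (f : nat -> R) (l : nat) (r k b mu : R) (z0 z : 'rV[R]_n)
    (e e' : nat -> 'rV[R]_n) (t : nat) :
  (forall j (s : R), (j.+1 < p)%N -> is_derive s 1 (G j) (G j.+1 s)) ->
  (forall j (s : R), (j < p)%N -> s <= 0 -> G j s = 0) ->
  0 <= T ->
  (forall i, (i <= t)%N -> e i = e' i) ->
  (forall i, (t <= i)%N -> dotp (e i) (z - z0) = 0) ->
  (forall i, (t <= i)%N -> dotp (e' i) (z - z0) = 0) ->
  @oracle R n p (chain_op G T f l r k b mu z0 e) z =
  @oracle R n p (chain_op G T f l r k b mu z0 e') z.
Proof.
move=> DG G0 T0 ee e0 e0'.
apply: functional_extensionality_dep => j; apply/funext => hs.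
have hsp : (size hs < p)%N by rewrite size_tuple.
rewrite /oracle /Dn /chain_op !(Dseq_ridge_op _ _ _ _ DG hsp).
rewrite -![(_ + _ : _ -> _) _]/(_ + _) ee//; congr (_ + _).
have Z (m : ridge R n) : dotp m.1.1 (z - z0) = 0 -> 0 <= m.1.2 ->
    (G (size hs) (dotp (scale_ridge r k m).1.1 (z - z0) - (scale_ridge r k m).1.2) *
     \prod_(h <- hs) dotp (scale_ridge r k m).1.1 h) *: (scale_ridge r k m).2 = 0.
  move=> m0 tau0; rewrite /= dotpZl m0 mulr0 sub0r G0 ?oppr_le0// mul0r.
  exact: scale0r.
rewrite /ridge_sum !big_chain; congr (_ + (_ + _)).
- apply: eq_bigr => i _; have [it|ti] := leqP i t; first by rewrite ee.
  have [d d'] := (e0 i (ltnW ti), e0' i (ltnW ti)).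
  by rewrite /friction_ridges !big_cons !big_nil !Z//= mulr_ge0.
(* For [i < t] both ends of the link have index at most [t], where the frames agree; for [i >= t]
   both coordinates vanish. *)
- apply: eq_bigr => i _; have [it|ti] := ltnP i t.
    by rewrite !ee// ltnW.
  have [d d'] := (e0 i ti, e0' i ti).
  have [d1 d1'] := (e0 i.+1 (leqW ti), e0' i.+1 (leqW ti)).
  have T4 : 0 <= 4 * T by rewrite mulr_ge0.
  have ZB (u v : 'rV[R]_n) c : dotp u (z - z0) = 0 -> dotp v (z - z0) = 0 ->
      dotp (u - c *: v) (z - z0) = 0.
    by move=> uz vz; rewrite dotpBl dotpZl uz vz mulr0 subr0.
  by rewrite /link_ridges !big_cons !big_nil !Z//= ZB.
- have [it|ti] := leqP l t; first by rewrite ee.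
  by rewrite !Z//= ?e0 ?e0' ?mulr_ge0// ltnW.
Qed.

Lemma exists_orthogonal_unit (R : realType) (n : nat) (s : seq 'rV[R]_n) :
  (size s < n)%N ->
  exists u : 'rV[R]_n, dotp u u = 1 /\ forall x, x \in s -> dotp x u = 0.
Proof.
move=> sn; pose M := \matrix_(i < size s) (s`_i)%R.
have : kermx M^T != 0.
  rewrite kermx_eq0 /row_free mxrank_tr ltn_eqF//.
  exact: leq_ltn_trans (rank_leq_row _) sn.
case/rowV0Pn => v /sub_kermxP vM v0.
have vs x : x \in s -> dotp x v = 0.
  move=> xs; have ix : (index x s < size s)%N by rewrite index_mem.
  have := congr1 (fun w : 'rV_(size s) => w ord0 (Ordinal ix)) vM.
  rewrite !mxE => <-; apply: eq_bigr => i _.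
  by rewrite !mxE /= nth_index// mulrC.
have vp : 0 < dotp v v.
  rewrite lt_def dotp_ge0 andbT; apply: contra v0 => /eqP/dotp_eq0 ->.
  by rewrite eqxx.
exists ((enorm v)^-1 *: v); split=> [|x xs]; last by rewrite dotpZr vs// mulr0.
rewrite dotpZl dotpZr mulrA -expr2 exprVn sqr_enorm mulVf ?gt_eqF//.
Qed.

(* The [t+1]-st vector is chosen orthogonal to the iterates of the operator built
   on the first [t+1] vectors followed by zeros. *)
Lemma resisting_frame (R : realType) (n p N : nat) (A : method R n p)
    (z0 : 'rV[R]_n) (F : (nat -> 'rV[R]_n) -> 'rV[R]_n -> 'rV[R]_n) :
  (2 * N < n)%N ->
  (forall t e e' z, (t <= N)%N -> (forall i, (i <= t)%N -> e i = e' i) ->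
     (forall i, (t <= i)%N -> dotp (e i) (z - z0) = 0) ->
     (forall i, (t <= i)%N -> dotp (e' i) (z - z0) = 0) ->
     @oracle R n p (F e) z = @oracle R n p (F e') z) ->
  exists e : nat -> 'rV[R]_n,
    (forall i j, (i < N.+1)%N -> (j < N.+1)%N -> dotp (e i) (e j) = (i == j)%:R) /\
    dotp (e N) (iterate A z0 (F e) N - z0) = 0.
Proof.
move=> Nn loc.
(* Stated for all lists so that choice yields a total function; 0 is the default for lists that are
   too long. *)
have ex (s : seq 'rV[R]_n) : exists u : 'rV[R]_n, (size s < n)%N ->
    dotp u u = 1 /\ forall x, x \in s -> dotp x u = 0.
  have [sn|ns] := ltnP (size s) n; last by exists 0.
  by have [u Hu] := exists_orthogonal_unit sn; exists u.
have [pick pickP] := choice ex.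
(* For [t < N] this list has [2 (t + 1) <= 2 N < n] entries, which leaves room for an orthogonal
   unit vector. The iterate of index 0 is [z0] itself and contributes nothing. *)
pose avoid t (e : nat -> 'rV[R]_n) :=
  [seq e i | i <- iota 0 t.+1] ++
  [seq iterate A z0 (F e) s - z0 | s <- iota 1 t.+1].
pose build := fix build t : nat -> 'rV[R]_n :=
  if t is s.+1 then
    fun i => if i == s.+1 then pick (avoid s (build s)) else build s i
  else fun i => if i == 0%N then pick [::] else 0.
have build_gt t i : (t < i)%N -> build t i = 0.
  elim: t => [|t IH] ti /=; first by rewrite gtn_eqF.
  by rewrite gtn_eqF// IH// ltnW.
have build_le t t' i : (i <= t)%N -> (t <= t')%N -> build t' i = build t i.
  move=> it; elim: t' => [|t' IH]; first by rewrite leqn0 => /eqP ->.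
  rewrite leq_eqVlt => /orP[/eqP -> //|]; rewrite ltnS => tt'.
  by rewrite /= ltn_eqF ?IH// ltnS (leq_trans it).
have unit_build t : (t <= N)%N -> dotp (build t t) (build t t) = 1.
  case: t => [|t] tN; rewrite /= ?eqxx.
    by have /pickP[] : (size ([::] : seq 'rV[R]_n) < n)%N by move: Nn => /=; lia.
  have /pickP[] // : (size (avoid t (build t)) < n)%N.
  by rewrite size_cat !size_map !size_iota; lia.
have orth_build t x : (t < N)%N -> x \in avoid t (build t) ->
    dotp x (build t.+1 t.+1) = 0.
  move=> tN xs; rewrite /= eqxx.
  have /pickP[_] : (size (avoid t (build t)) < n)%N.
    by rewrite size_cat !size_map !size_iota; lia.
  by apply.
set e := build N.
have eE t i : (i <= t)%N -> (t <= N)%N -> e i = build t i.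
  by move=> it tN; apply: build_le.
have orth i j : (i < j)%N -> (j <= N)%N -> dotp (e i) (e j) = 0.
  case: j => // j ij jN; rewrite (eE j.+1 j.+1)// (eE j i)//; last exact: ltnW.
  apply: orth_build => //; rewrite mem_cat; apply/orP; left.
  by apply/mapP; exists i => //; rewrite mem_iota add0n.
(* [perp] and [same] form one induction on [s]. The first [s] outputs depend on [e 0, ..., e s.-1]
   only, whence the condition [s <= t.+1]. *)
have perp s : (s <= N)%N ->
  (forall t, (s <= t.+1)%N -> (t <= N)%N -> outputs A z0 (F e) s = outputs A z0 (F (build t)) s) ->
  forall i, (s <= i)%N -> dotp (e i) (iterate A z0 (F e) s - z0) = 0.
  move=> sN same i si; have [iN|Ni] := leqP i N; last first.
    by rewrite /e build_gt// dotpC linear0.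
  case: s sN same si => [|s] sN same si.
    by rewrite /iterate /= subrr linear0.
  case: i iN si => // i iN si; rewrite dotpC.
  have -> : iterate A z0 (F e) s.+1 = iterate A z0 (F (build i)) s.+1.
    by rewrite /iterate (same i)// ltnW.
  rewrite (eE i.+1)//; apply: orth_build => //.
  rewrite mem_cat; apply/orP; right; apply/mapP; exists s.+1 => //.
  by rewrite mem_iota; lia.
have same s : forall t, (s <= t.+1)%N -> (t <= N)%N ->
    outputs A z0 (F e) s = outputs A z0 (F (build t)) s.
  elim: s => [//|s IH] t; rewrite ltnS => st tN.
  have IHt : outputs A z0 (F e) s = outputs A z0 (F (build t)) s.
    by apply: IH => //; exact: leqW.
  rewrite /= -IHt; congr rcons.
  have P := perp s (leq_trans st tN) IH.
  apply: (loc t) => // [i it|i ti|i ti].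
  - exact: eE.
  - by apply: P; apply: leq_trans ti.
  - have [it|lti] := leqP i t; last by rewrite build_gt// dotpC linear0.
    by rewrite -(eE t i)//; apply: P; apply: leq_trans ti.
exists e; split; last by apply: perp => // t Nt tN; exact: same.
move=> i j iN jN; have [ij|ji|->] := ltngtP i j.
- by rewrite orth.
- by rewrite dotpC orth.
- by rewrite (eE j)// unit_build.
Qed.

(** * The hard instance *)

(** Level 0 is [g], level 1 its slope, a smooth step, and level [p.-1] is piecewise linear, hence
    Lipschitz. *)
Definition spline_tower (R : realType) (p j : nat) : R -> R := spl p.-1 (p - j).

Lemma spline_tower_derive (R : realType) (p j : nat) (t : R) :
  (j.+1 < p)%N -> is_derive t 1 (@spline_tower R p j) (@spline_tower R p j.+1 t).
Proof.
move=> jp; rewrite /spline_tower.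
have [-> ->] : (p - j = (p - j.+2).+2)%N /\ (p - j.+1 = (p - j.+2).+1)%N by lia.
exact: is_derive_spl.
Qed.

Lemma spline_tower_le0 (R : realType) (p j : nat) (t : R) :
  (j < p)%N -> t <= 0 -> @spline_tower R p j t = 0.
Proof. by move=> jp; apply: spl_le0; rewrite subn_gt0. Qed.

Lemma spline_tower_lipschitz (R : realType) (p : nat) (s t : R) : (0 < p)%N ->
  `|@spline_tower R p p.-1 s - @spline_tower R p p.-1 t| <= 2 ^+ p.-1 * `|s - t|.
Proof.
move=> p0; rewrite /spline_tower; have -> : (p - p.-1 = 1)%N by lia.
exact: spl1_lipschitz.
Qed.

Lemma spline_tower_ramp (R : realType) (p : nat) : (1 < p)%N ->
  ramp p.-1%:R (@spline_tower R p 0) (@spline_tower R p 1).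
Proof.
case: p => [|[|q]] // _; have [b01 b1 mono] := splineP R q.
have E : @spline_tower R q.+2 1 = spl q.+1 q.+1 by rewrite /spline_tower subn1.
split; rewrite ?E.
- by rewrite -E => t; apply: spline_tower_derive.
- by rewrite ltr0n.
- by move=> t; have /andP[] := b01 t.
- by move=> t; have /andP[] := b01 t.
- exact: mono.
- by move=> t; apply: spl_le0.
- exact: b1.
- by move=> t; apply: spline_tower_le0.
Qed.

Lemma lipschitz_continuous (R : realType) (f : R -> R) (M : R) :
  (forall s t, `|f s - f t| <= M * `|s - t|) -> continuous f.
Proof.
move=> fM x.
have M0 : 0 <= M.
  by have := le_trans (normr_ge0 _) (fM 1 0); rewrite subr0 normr1 mulr1.
apply/cvgrPdist_le => /= e e0; near=> y.
apply: le_trans (fM _ _) _.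
apply: (@le_trans _ _ (M * (e / (M + 1)))).
  rewrite ler_wpM2l//; apply: ltW; near: y.
  by apply: cvgr_dist_lt => //; rewrite divr_gt0// ltr_wpDl.
by rewrite mulrCA ger_pMr// ler_pdivrMr ?ltr_wpDl// mul1r lerDl.
Unshelve. all: by end_near. Qed.

(* With [X = |z - zs|], monotonicity gives [|F z| X >= a X^2 + c] where [a] comes
   from the strongly monotone part and [c] from the absorbing ridge at the hidden
   coordinate; AM-GM then eliminates [X]. *)
Lemma chain_op_residual (R : realType) (n : nat) (G : nat -> R -> R) (T : R)
    (dg : R -> R) (f : nat -> R) (l : nat) (r k b mu : R) (z0 z zs : 'rV[R]_n)
    (e : nat -> 'rV[R]_n) (W : R) :
  ramp T (G 0%N) dg -> 0 < r -> 0 < k -> 0 < mu ->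
  (forall i, (i <= l)%N -> 1 <= f i) ->
  chain_op G T f l r k b mu z0 e zs = 0 ->
  r * dotp (e l) (zs - z0) = W -> dotp (e l) (z - z0) = 0 ->
  0 < G 0%N (W - 4 * T) * W ->
  4 * k ^+ 2 * mu * (G 0%N (W - 4 * T) * W) <=
    enorm (chain_op G T f l r k b mu z0 e z) ^+ 2.
Proof.
move=> rg r0 k0 mu0 f1 Fzs eW ez; set P := G 0%N (W - 4 * T) * W => P0.
have := chain_op_monotone b mu z0 z zs e rg r0 (ltW k0) f1.
rewrite /= Fzs subr0 eW ez mulr0 !sub0r (ramp_g0 rg); last first.
  by have := ramp_T rg; lra.
rewrite sub0r mulrNN -/P -sqr_enorm.
set X := enorm (z - zs) => H.
have := le_trans H (dotp_le_enorm _ _).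
set V := enorm (chain_op _ _ _ _ _ _ _ _ _ _ _); rewrite -/X => {}H.
have X0 : 0 <= X by exact: enorm_ge0.
have V0 : 0 <= V by exact: enorm_ge0.
have kP : 0 < k / r * P by rewrite mulr_gt0// divr_gt0.
have a0 : 0 < k * mu * r by rewrite !mulr_gt0.
have Xp : 0 < X.
  rewrite lt_def X0 andbT; apply/eqP => Xz; move: H; rewrite Xz; lra.
have -> : 4 * k ^+ 2 * mu * P = 4 * ((k * mu * r) * (k / r * P)).
  by field; rewrite gt_eqF.
move: (k * mu * r) (k / r * P) kP a0 H => a c c0 a0 H.
rewrite -(ler_pM2r (exprn_gt0 2 Xp)) -[leRHS]exprMn.
apply: (@le_trans _ _ ((a * X ^+ 2 + c) ^+ 2)).
  by rewrite -subr_ge0; have -> : (a * X ^+ 2 + c) ^+ 2 - 4 * (a * c) * X ^+ 2 =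
    (a * X ^+ 2 - c) ^+ 2 by [ring]; exact: sqr_ge0.
rewrite ler_pXn2r// ?nnegrE ?mulr_ge0// addr_ge0 ?mulr_ge0 ?sqr_ge0//; exact: ltW.
Qed.

(** An arithmetic progression of step [- 40 T] from [80 T (N + 1)] to [40 T (N + 2)]: every
    coordinate is of order [N], and no two differ by a factor 2. *)
Definition zero_coord (R : realType) (T : R) (N i : nat) : R :=
  40 * T * (2 * N.+1%:R - i%:R).

(* Chosen so that friction and the linear term add up to [80 T] at each node
   ([40 T] at the last one), the decrease of [zero_coord] over the two links at
   that node. *)
Definition friction_coef (R : realType) (T mu : R) (N i : nat) : R :=
  ((if i == N then 40 else 80) * T - mu * zero_coord T N i) / (20 * T).

Lemma zero_coord_bounds (R : realType) (T : R) (N i : nat) :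
  0 < T -> (i <= N)%N ->
  40 * T * (N.+1%:R + 1) <= zero_coord T N i <= 80 * T * N.+1%:R.
Proof.
move=> T0 iN; have i0 : 0 <= i%:R :> R by rewrite ler0n.
have : i%:R <= N%:R :> R by rewrite ler_nat.
rewrite /zero_coord -[N.+1%:R]natr1 => iN'; apply/andP; split; nra.
Qed.

(** With [mu = 1 / (4 (N + 1))] the linear term is at most [20 T], so the friction supplies between
    [40 T - 20 T] and [80 T]. *)
Lemma friction_coef_bounds (R : realType) (T : R) (N i : nat) :
  0 < T -> (i <= N)%N -> 1 <= friction_coef T (4 * N.+1%:R)^-1 N i <= 4.
Proof.
move=> T0 iN; have /andP[W1 W2] := zero_coord_bounds T0 iN.
have m0 : 0 < N.+1%:R :> R by rewrite ltr0n.
set y := (4 * N.+1%:R)^-1 * zero_coord T N i.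
have y1 : y <= 20 * T.
  by rewrite /y mulrC ler_pdivrMr; [nra | rewrite mulr_gt0].
have y0 : 0 <= y.
  apply: mulr_ge0; first by rewrite invr_ge0 mulr_ge0 ?ltW.
  by apply: le_trans W1; nra.
rewrite /friction_coef -/y ler_pdivlMr ?ler_pdivrMr ?mulr_gt0//.
by case: ifP => _; apply/andP; split; lra.
Qed.

(** Slope 1 past [T] gives [g (W - 4T) >= W - 5T >= W / 2], so the product is at least [W^2 / 2], of
    order [(N + 1)^2]; the factor [4 mu = 1 / (N + 1)] leaves order [N + 1]. *)
Lemma zero_coord_residual (R : realType) (T : R) (g dg : R -> R) (N : nat) :
  ramp T g dg ->
  0 < g (zero_coord T N N - 4 * T) * zero_coord T N N /\
  400 * T ^+ 2 * N.+1%:R <= 4 * (4 * N.+1%:R)^-1 *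
    (g (zero_coord T N N - 4 * T) * zero_coord T N N).
Proof.
move=> rg; set W := zero_coord T N N; have T0 := ramp_T rg.
have /andP[W1 _] := zero_coord_bounds T0 (leqnn N); rewrite -/W in W1.
have m0 : 0 < N.+1%:R :> R by rewrite ltr0n.
set m : R := N.+1%:R in W1 m0 *.
have Tm : 0 < T * m by rewrite mulr_gt0.
have m1 : 1 <= m by rewrite /m ler1n.
have gT : 0 <= g T.
  have [c _] := MVT_all (ltW T0) (ramp_derive rg).
  by rewrite (ramp_g0 rg (lexx 0)) !subr0 => ->; rewrite mulr_ge0 ?(ramp_ge0 rg) ?ltW.
have gW : 1 / 2 * W <= g (W - 4 * T).
  have : g (W - 4 * T) - g T = W - 4 * T - T by apply: ramp_affine rg _ _; nra.
  nra.
have W0 : 40 * (T * m) <= W by nra.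
split; first by apply: mulr_gt0; nra.
have -> : 4 * (4 * m)^-1 = m^-1 by field; rewrite gt_eqF.
rewrite [leRHS]mulrC ler_pdivlMr//.
apply: (@le_trans _ _ (1 / 2 * W * W)); last first.
  by rewrite ler_wpM2r//; nra.
have : 40 * (T * m) * (40 * (T * m)) <= W * W by apply: ler_pM => //; nra.
rewrite !expr2; nra.
Qed.

(** Here [D0] is the norm of the unscaled zero and [s] the square root of [N + 1]. As [k] is
    proportional to [Lp * D ^+ p / D0 ^+ p] and [D0] is at most of order [s ^+ 3], the residual
    [k s] is at least of order [s ^ (1 - 3 p)]. *)
Lemma final_bound (R : realType) (p : nat) (T M Lp D D0 m s V r k : R) :
  (0 < p)%N -> 0 < T -> 0 < M -> 0 < Lp -> 0 < D -> 0 < D0 -> 0 < s ->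
  r = D0 / D -> k = Lp / (M * (100 * r) ^+ p * 100) ->
  m = s ^+ 2 -> D0 <= 80 * T * s ^+ 3 -> 20 * k * T * s <= V ->
  20 * T / (M * 100 ^+ p * 100 * (80 * T) ^+ p) *
    (Lp * D ^+ p / (m `^ ((3 * p%:R - 1) / 2))) <= V.
Proof.
move=> p0 T0 M0 L0 D0' DD0 s0 -> -> ms DD VV; apply: le_trans VV.
have -> : m `^ ((3 * p%:R - 1) / 2) = s ^+ (3 * p - 1).
  rewrite ms -powR_mulrn ?ltW// -powRrM.
  have -> : 2%:R * ((3 * p%:R - 1) / 2) = (3 * p - 1)%:R :> R.
    rewrite natrB ?natrM; last by lia.
    by field.
  by rewrite powR_mulrn// ltW.
have sp : s ^+ (3 * p) = s * s ^+ (3 * p - 1) by rewrite -exprS; congr (_ ^+ _); lia.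
have sq : 0 < s ^+ (3 * p - 1) by rewrite exprn_gt0.
have Dp : D0 ^+ p <= (80 * T) ^+ p * s ^+ (3 * p).
  rewrite exprM -exprMn; apply: lerXn2r => //; rewrite nnegrE; first exact: ltW.
  by apply: ltW; rewrite !mulr_gt0// exprn_gt0.
have a0 : 0 < (80 * T) ^+ p by rewrite exprn_gt0// mulr_gt0.
have b0 : 0 < D0 ^+ p by rewrite exprn_gt0.
have c0 : 0 < D ^+ p by rewrite exprn_gt0.
have d0 : 0 < (100 : R) ^+ p by rewrite exprn_gt0.
rewrite [(100 * (D0 / D)) ^+ p]exprMn [(D0 / D) ^+ p]expr_div_n.
move: Dp a0 b0 c0 d0 sq; rewrite {}sp.
move: ((80 * T) ^+ p) (D0 ^+ p) (D ^+ p) ((100 : R) ^+ p) (s ^+ (3 * p - 1)) => a b c d q.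
move=> bq a0 b0 c0 d0 q0.
have -> : 20 * T / (M * d * 100 * a) * (Lp * c / q) =
    20 * T * Lp * c * s / (M * d * 100) * (a * (s * q))^-1.
  by field; rewrite !gt_eqF.
have -> : 20 * (Lp / (M * (d * (b / c)) * 100)) * T * s =
    20 * T * Lp * c * s / (M * d * 100) * b^-1.
  by field; rewrite !gt_eqF.
apply: ler_wpM2l; first by rewrite divr_ge0 ?mulr_ge0 ?ltW.
by rewrite lef_pV2// posrE !mulr_gt0.
Qed.

Lemma ramp_monotone (R : realType) (T : R) (g dg : R -> R) (x y t : R) :
  ramp T g dg -> 0 <= (g (x - t) - g (y - t)) * (x - y).
Proof.
move=> rg; have form s : 0 <= \sum_(m <- [:: (x - y, y - t, x - y)])
    dg (m.1.1 * s + m.1.2) * m.1.1 * m.2.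
  by rewrite big_seq1 -mulrA mulr_ge0 ?(ramp_ge0 rg)// -expr2 sqr_ge0.
have := ridge_increment_ge0 (ramp_derive rg) form.
by rewrite big_seq1 /= addrA subrK.
Qed.

Theorem theorem6p1 (R : realType) (p : nat) (hp : (2 <= p)%N) :
  exists Cp : R, 0 < Cp /\
    forall (N : nat) (Lp D : R) (n : nat) (z0 : 'rV[R]_n),
      (1 <= N)%N -> 0 < Lp -> 0 < D -> (2 * N + 1 <= n)%N ->
      forall A : method R n p,
      exists F : 'rV[R]_n -> 'rV[R]_n,
        [/\ is_Ck p.-1 F,
            monotone_op F,
            lipschitz_order p Lp F,
            (exists zs : 'rV[R]_n,
               [/\ F zs = 0,
                   (forall z : 'rV[R]_n, F z = 0 -> z = zs) &
                   enorm (z0 - zs) = D]) &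
            let zN := iterate A z0 F N in
            res_tan F (fun=> [set 0]) zN = (enorm (F zN))%:E /\
            enorm (F zN) >=
              Cp * (Lp * D ^+ p / (N.+1%:R `^ ((3 * p%:R - 1) / 2)))].
Proof.
pose T : R := p.-1%:R; pose M : R := 2 ^+ p.-1.
have T0 : 0 < T by rewrite ltr0n; lia.
have M0 : 0 < M by rewrite exprn_gt0.
exists (20 * T / (M * 100 ^+ p * 100 * (80 * T) ^+ p)); split.
  by rewrite divr_gt0 ?mulr_gt0// exprn_gt0// mulr_gt0.
move=> N Lp D n z0 N1 L0 D0 nN A.
pose G := @spline_tower R p; have rg : ramp T (G 0%N) (G 1%N) := spline_tower_ramp R hp.
have DG j (t : R) : (j.+1 < p)%N -> is_derive t 1 (G j) (G j.+1 t).
  exact: spline_tower_derive.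
have p0 : (0 < p)%N by lia.
have LG s t := @spline_tower_lipschitz R p s t p0.
pose m : R := N.+1%:R; pose mu := (4 * m)^-1.
have m0 : 0 < m by rewrite ltr0n.
have mu0 : 0 < mu by rewrite invr_gt0 mulr_gt0.
pose W := zero_coord T N; pose f := friction_coef T mu N.
have WB i : (i <= N)%N -> 40 * T * (m + 1) <= W i <= 80 * T * m.
  exact: zero_coord_bounds.
have fB i : (i <= N)%N -> 1 <= f i <= 4 by exact: friction_coef_bounds.
have W0 i : (i <= N)%N -> 0 < W i.
  move=> /WB/andP[+ _]; apply: lt_le_trans.
  by rewrite !mulr_gt0// addr_gt0.
(* The norm of the unscaled zero depends on its coordinates only, so [r], [k] and [b] are fixed
   before the frame is chosen. *)
pose S := \sum_(i < N.+1) W i ^+ 2; pose D1 := Num.sqrt S.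
have S0 : 0 < S.
  rewrite /S big_ord_recl ltr_wpDr ?exprn_gt0 ?W0//.
  by apply: sumr_ge0 => i _; exact: sqr_ge0.
have D10 : 0 < D1 by rewrite sqrtr_gt0.
pose r := D1 / D; have r0 : 0 < r by rewrite divr_gt0.
(* Solves [M * (100 r)^p * (100 k) = Lp], the constant given by [lipschitz_ridge_op]. *)
pose k := Lp / (M * (100 * r) ^+ p * 100).
have q0 : 0 < M * (100 * r) ^+ p * 100.
  by do 2?[apply: mulr_gt0 => //]; apply: exprn_gt0; exact: mulr_gt0.
have k0 : 0 < k by exact: divr_gt0.
pose b := f 0%N * (20 * T) + mu * W 0%N + G 0%N (W 1%N - 4 * T).
pose F := chain_op G T f N r k b mu z0.
have [] := @resisting_frame R n p N A z0 F.
- by move: nN; rewrite addn1.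
- move=> t e e' z _ ee e0 e0'; apply: (oracle_chain_op_eq _ _ _ _ _ _ DG _ _ ee e0 e0').
    by move=> j s; exact: spline_tower_le0.
  exact: ltW.
move=> e [orth eN].
have [bA bB] : (forall x, \sum_(q <- [seq scale_ridge r k q | q <- chain_ridges T f N e])
      dotp q.1.1 x ^+ 2 <= (100 * r) ^+ 2 * dotp x x) /\
    (forall x, \sum_(q <- [seq scale_ridge r k q | q <- chain_ridges T f N e])
      dotp q.2 x ^+ 2 <= (100 * k) ^+ 2 * dotp x x).
  have f04 i : (i <= N)%N -> 0 <= f i <= 4.
    by move=> /fB/andP[f1 ->]; rewrite (le_trans ler01).
  by split=> x; have [] := @chain_bessel R n T f N r k e x f04 orth.
have f1 i : (i <= N)%N -> 1 <= f i by move=> /fB/andP[].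
pose zs := z0 + \sum_(i < N.+1) (r^-1 * W i) *: e i.
have fE i : f i * (20 * T) = (if i == N then 40 else 80) * T - mu * W i.
  by rewrite /f /friction_coef divfK// gt_eqF// mulr_gt0.
have WS i : W i.+1 = W i - 40 * T by rewrite /W /zero_coord -[i.+1%:R]natr1; ring.
have m1 : 1 <= m by rewrite ler1n.
have Fzs : F e zs = 0.
  (* [N >= 1] separates the source node from the absorbing node. *)
  have [l Nl] : exists l, N = l.+1 by exists N.-1; rewrite prednK.
  have := @chain_op_zero R n G T (G 1%N) f W l r k mu z0 e rg r0; rewrite -Nl; apply.
  - exact: orth.
  - by move=> i /WB/andP[w1 _]; nra.
  - move=> i il; have /WB/andP[w1 _] : (i <= N)%N by rewrite Nl leqW.
    by rewrite WS; split; nra.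
  - move=> i il; have iN : i.+1 == N = false by rewrite Nl eqSS (ltn_eqF il).
    by rewrite fE !WS iN; ring.
  - have WN : W N = W l - 40 * T by rewrite -WS -Nl.
    by rewrite fE eqxx WN; ring.
have strong z z' : k * mu * r * dotp (z - z') (z - z') <= dotp (F e z - F e z') (z - z').
  apply: le_trans (chain_op_monotone b mu z0 z z' e rg r0 (ltW k0) f1).
  rewrite lerDl; apply: mulr_ge0; first by rewrite divr_ge0 ?ltW.
  exact: ramp_monotone rg.
have kmr0 : 0 < k * mu * r by apply: mulr_gt0 => //; exact: mulr_gt0.
have rzs : r * dotp (e N) (zs - z0) = W N.
  rewrite /zs addrC addKr linear_sum big_ord_recr /= dotpZr orth// eqxx mulr1.
  rewrite big1 ?add0r ?mulVKf ?gt_eqF// => i _.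
  by rewrite dotpZr orth ?(leqW (ltn_ord i))// gtn_eqF ?mulr0.
exists (F e); split.
- apply: ridge_op_is_Ck => //; exact: lipschitz_continuous LG.
- move=> z z'; apply: le_trans (strong z z').
  exact: mulr_ge0 (ltW kmr0) (dotp_ge0 _).
- have -> : Lp = M * (100 * r) ^+ p * (100 * k).
    have Q : Lp = k * (M * (100 * r) ^+ p * 100) by rewrite /k divfK// gt_eqF.
    by rewrite {1}Q; ring.
  have r100 : 0 <= 100 * r by apply: mulr_ge0 => //; exact: ltW.
  have k100 : 0 <= 100 * k by apply: mulr_ge0 => //; exact: ltW.
  exact: lipschitz_ridge_op hp DG LG (ltW M0) r100 k100 bA bB.
- exists zs; split=> // [z Fz|].
    apply/eqP; rewrite -subr_eq0; apply/eqP/dotp_eq0/eqP.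
    rewrite eq_le dotp_ge0 andbT; have := strong z zs.
    by rewrite Fz Fzs subrr (dotpC 0) linear0 pmulr_rle0.
  rewrite /enorm /zs opprD addrA subrr add0r -scaleN1r dotpZl dotpZr mulrA mulrNN.
  rewrite !mul1r (parseval (fun i => r^-1 * W i) orth).
  have -> : \sum_(i < N.+1) (r^-1 * W i) ^+ 2 = r^-1 ^+ 2 * S.
    by rewrite /S mulr_sumr; apply: eq_bigr => i _; rewrite exprMn.
  rewrite sqrtrM ?sqr_ge0// sqrtr_sqr ger0_norm ?invr_ge0 ?(ltW r0)//.
  by rewrite -/D1 /r; field; rewrite !gt_eqF.
- move=> zN; split; first by rewrite /res_tan image_set1 ereal_inf1 addr0.
  have [P0 P1] := zero_coord_residual N rg.
  have := chain_op_residual rg r0 k0 mu0 f1 Fzs rzs eN P0; rewrite -/zN.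
  set V := enorm _ => HV.
  have V0 : 0 <= V by exact: enorm_ge0.
  pose s := Num.sqrt m; have s0 : 0 < s by rewrite sqrtr_gt0.
  have sm : m = s ^+ 2 by rewrite sqr_sqrtr// ltW.
  apply: (@final_bound R p T M Lp D D1 m s V r k) => //.
    (* [D1 ^+ 2] is a sum of [N + 1] terms, each at most [(80 T m) ^+ 2]. *)
    have bb : 0 <= 80 * T * s ^+ 3 by rewrite !mulr_ge0 ?exprn_ge0 ?ltW.
    rewrite -(ger0_norm bb) -sqrtr_sqr ler_wsqrtr//.
    have -> : (80 * T * s ^+ 3) ^+ 2 = (80 * T * m) ^+ 2 * m by rewrite sm; ring.
    apply: (@le_trans _ _ (\sum_(i < N.+1) (80 * T * m) ^+ 2)).
      apply: ler_sum => i _; have iN : (i <= N)%N by rewrite -ltnS.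
      have /andP[_ w2] := WB i iN.
      by apply: lerXn2r => //; rewrite nnegrE ltW ?W0// !mulr_gt0.
    by rewrite sumr_const card_ord -[X in X <= _]mulr_natr lexx.
  have kT0 : 0 <= 20 * k * T * s.
    by apply: ltW; do 3?[apply: mulr_gt0 => //].
  rewrite -(@ler_pXn2r _ 2) ?nnegrE//.
  apply: le_trans HV.
  have -> : (20 * k * T * s) ^+ 2 = k ^+ 2 * (400 * T ^+ 2 * m) by rewrite sm; ring.
  have -> : forall P, 4 * k ^+ 2 * mu * P = k ^+ 2 * (4 * mu * P) by move=> P; ring.
  by rewrite ler_wpM2l ?sqr_ge0.
Qed.
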